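(* Let $z=(z_\alpha)_{\alpha\in\mathbb{N}^n}$ be the moment sequence of a finite Borel measure $\mu$ on $\mathbb{R}^n$ (all of whose moments are finite), i.e. $z_\alpha=\int_{\mathbb{R}^n}X^\alpha\,d\mu$ for all $\alpha\in\mathbb{N}^n$, and assume that $z$ satisfies the generalized Carleman condition, i.e. $$\sum_{k=1}^\infty L_z(X_i^{2k})^{-1/(2k)}=\infty\qquad\text{for all } i=1,\ldots,n.$$ Let $y=(y_\alpha)_{\alpha\in\mathbb{N}^n}$ be a real sequence. If there exists a scalar $\kappa>0$ such that $$0\le L_y(f^2)\le \kappa\,L_z(f^2)\qquad\text{for all } f\in\mathbb{R}[X],$$ then $y$ has a representing Borel measure $\nu$ on $\mathbb{R}^n$ which is uniformly absolutely continuous with respect to $\mu$.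
   Context: Here $\mathbb{N}=\{0,1,2,\ldots\}$, $\mathbb{R}[X]=\mathbb{R}[X_1,\ldots,X_n]$, and $X^\alpha=\prod_{i=1}^n X_i^{\alpha_i}$. Measures are nonnegative. For a real sequence $y=(y_\alpha)_{\alpha\in\mathbb{N}^n}$, $L_y:\mathbb{R}[X]\to\mathbb{R}$ is the linear functional $f=\sum_\alpha f_\alpha X^\alpha\mapsto L_y(f)=\sum_\alpha f_\alpha y_\alpha$ (and similarly $L_z$). A sequence $y$ has a representing measure $\nu$ on $\mathbb{R}^n$ if $\nu$ is a Borel measure on $\mathbb{R}^n$ with $y_\alpha=\int X^\alpha\,d\nu$ for all $\alpha\in\mathbb{N}^n$. A measure $\nu$ on $\mathbb{R}^n$ is uniformly absolutely continuous with respect to $\mu$ if $\nu\ll\mu$ and the Radon–Nikodym derivative $h=d\nu/d\mu$ belongs to $L_\infty(\mathbb{R}^n,\mu)$. In the Carleman condition, a term with $L_z(X_i^{2k})=0$ is read as $+\infty$. *)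

(* Defs.v *)
From HB Require Import structures.
From mathcomp Require Import all_boot all_order all_algebra.
From mathcomp Require Import all_classical all_reals all_analysis.
From mathcomp Require mpoly.
(* The notations of mpoly clash with those of analysis. *)
Import (canonicals, coercions) mpoly.

Set Implicit Arguments.
Unset Strict Implicit.
Unset Printing Implicit Defensive.
Import Order.TTheory GRing.Theory Num.Theory.
Import numFieldNormedType.Exports.
Local Open Scope classical_set_scope.
Local Open Scope ring_scope.

(* R^n is [n.-tuple R] with the library's product sigma-algebra, generated by
   the coordinate projections into R with its Borel sets; for finite n this is
   the Borel sigma-algebra of the Euclidean topology. *)

Definition monomial (R : realType) (n : nat) (a : mpoly.multinom n)
    (x : n.-tuple R) : R :=
  \prod_(i < n) tnth x i ^+ a i.

(* Finiteness of all moments is part of the definition; the same notion serves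
   for "y has the representing measure mu". *)
Definition has_moments (R : realType) (n : nat)
    (mu : {measure set (n.-tuple R) -> \bar R}) (y : mpoly.multinom n -> R) :=
  forall a : mpoly.multinom n,
    mu.-integrable [set: n.-tuple R] (fun x => (monomial a x)%:E) /\
    (y a)%:E = (\int[mu]_x (monomial a x)%:E)%E.

Definition riesz_functional (R : realType) (n : nat) (y : mpoly.multinom n -> R)
    (f : mpoly.mpoly n R) : R :=
  \sum_(a <- mpoly.msupp f) mpoly.mcoeff a f * y a.

(* The case distinction is needed because [powR] has [0 `^ r = 0] for every
   [r != 0], including [r < 0]. *)
Definition carleman_term (R : realType) (n : nat) (z : mpoly.multinom n -> R)
    (i : 'I_n) (k : nat) : \bar R :=
  let m := riesz_functional z (mpoly.mpolyX R (mpoly.mnm1 i) ^+ (2 * k)) in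
  if m == 0 then +oo%E else (m `^ (- (2 * k)%:R^-1))%:E.

Definition generalized_carleman (R : realType) (n : nat)
    (z : mpoly.multinom n -> R) :=
  forall i : 'I_n, (\sum_(1 <= k <oo) carleman_term z i k)%E = +oo%E.

Definition uniformly_absolutely_continuous (R : realType) (n : nat)
    (nu mu : {finite_measure set (n.-tuple R) -> \bar R}) :=
  nu `<< mu /\
  (fine \o Radon_Nikodym (charge_of_finite_measure nu) mu) \in Lfun mu +oo%E.

(* Main.v *)
Require Import Defs.
From HB Require Import structures.
From mathcomp Require Import all_boot all_order all_algebra.
From mathcomp Require Import all_classical all_reals all_analysis.
From mathcomp Require Import measurable_realfun ess_sup_inf.
From mathcomp Require Import ring lra.
From mathcomp Require mpoly.
Import (canonicals, coercions) mpoly.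

Set Implicit Arguments.
Unset Strict Implicit.
Unset Printing Implicit Defensive.
Import Order.TTheory GRing.Theory Num.Theory.
Import numFieldNormedType.Exports.
Local Open Scope classical_set_scope.
Local Open Scope ring_scope.

(** Write E(f) for the integral of f^2 against mu.  Positivity of L_y on squares
    gives the Cauchy-Schwarz inequality L_y(f)^2 <= L_y(f^2) L_y(1), hence
    L_y(f)^2 <= kappa L_y(1) E(f): on polynomials, L_y is bounded for the norm of
    L^2(mu).  By the Riesz representation theorem ([riesz_representation]) there
    is h in L^2(mu) with L_y(f) = int f h dmu for every polynomial f.  The two
    inequalities of the hypothesis then say that h and kappa - h have nonnegative
    integral against the square of every polynomial, and it remains to see that
    this forces 0 <= h <= kappa almost everywhere ([ae_ge0_of_squares]): the
    measure nu = h mu is then the one required.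

    If the indicator of A = {h < 0} is a limit of polynomials p_k in L^2(|h| mu),
    then int p_k^2 h dmu tends to int_A h dmu, so that the latter is nonnegative
    and A is negligible.  To get such p_k, take the function H of L^2(mu) that
    represents p |-> int_A p |h| dmu on the space of the functions sqrt|h| p: the
    Riesz theorem also provides polynomials p_k with sqrt|h| p_k tending to H, and
    H is sqrt|h| times the indicator of A as soon as the function
    G = sqrt|h| (H - sqrt|h| 1_A), all of whose moments vanish, is zero.

    So everything rests on a uniqueness statement ([moments_eq0_ae_eq0]): if all
    moments of G mu vanish and G mu satisfies a Carleman bound in each coordinate,
    then G = 0.  Coordinates are treated one at a time: if h u^k has integral 0 for
    all k, then F(t) = int h cos(t u + b) dmu has all its derivatives zero at 0,
    and these derivatives are everywhere bounded by M_k = int |h u^k| dmu.  The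
    Denjoy-Carleman theorem, in Bang's form ([bang_vanishing]), gives F = 0
    ([cosine_transform_eq0]).  Trigonometric polynomials in u then approximate the
    indicator of {u > a} boundedly and pointwise ([halfline_Int0]), and a
    Dynkin-class argument passes from half-spaces to all Borel sets.

    The Carleman condition of the theorem concerns the roots m_{2k}^(1/2k) of the
    moments while Bang's theorem uses quotients of consecutive bounds; Carleman's
    inequality between the sum of a sequence and the sum of its geometric means
    ([carleman_inequality]) relates them.  Three uses of Cauchy-Schwarz bound the
    moments of G mu by the eighth roots of the moments m_{8k} of mu, which still
    satisfy the condition ([quasianalytic_root8]). *)

(** * Bang's theorem on quasi-analytic families *)

Definition divergent (R : realType) (a : nat -> R) :=
  forall A : R, exists n, A <= \sum_(1 <= k < n) a k.

(** Bounds M_k for successive derivatives.  The numbers p_k stand for the quotients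
    M_(k-1) / M_k; keeping them separate from M allows M_k = 0. *)
Definition quasianalytic (R : realType) (M : nat -> R) :=
  exists p : nat -> R, [/\ forall k, 0 < p k,
    forall i j, (i <= j)%N -> p j <= p i,
    forall k, p k.+1 * M k.+1 <= M k & divergent p].

Lemma sum_half_le (R : realFieldType) n : \sum_(j < n) (2^-1 : R) ^+ j <= 2.
Proof.
have h : (2^-1 : R) ^+ n - 1 = (2^-1 - 1) * \sum_(i < n) 2^-1 ^+ i by rewrite subrX1.
have p0 : 0 <= (2^-1 : R) ^+ n by rewrite exprn_ge0// invr_ge0.
lra.
Qed.

Lemma split_le_add (R : realFieldType) (a b t : R) : 0 < a -> 0 <= b ->
  `|t| <= a + b -> exists t' s, [/\ t = t' + s, `|t'| <= b & `|s| <= a].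
Proof.
move=> a0 b0 tab; have ab : 0 < a + b by lra.
have r1 : `|t / (a + b)| <= 1.
  by rewrite normrM normfV (gtr0_norm ab) ler_pdivrMr// mul1r.
exists (t / (a + b) * b), (t / (a + b) * a); split.
- by field; rewrite gt_eqF.
- by rewrite normrM (ger0_norm b0) ler_piMl.
- by rewrite normrM (gtr0_norm a0) ler_piMl// ltW.
Qed.

Section bang.
Variables (R : realType) (D : nat -> R -> R) (M p : nat -> R).
Hypothesis taylor : forall k m t s,
  `|D k (t + s) - \sum_(j < m) D (k + j)%N t * (s ^+ j / j`!%:R)| <=
  M (k + m)%N * (`|s| ^+ m / m`!%:R).
Hypotheses (p_gt0 : forall k, 0 < p k)
  (p_le : forall i j, (i <= j)%N -> p j <= p i)
  (p_ratio : forall k, p k.+1 * M k.+1 <= M k).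

(* |D k t| <= 2^(k - N) M k: with this discount, Taylor's formula loses only one
   unit of N over a step of length p_N / 4. *)
Let flat N t := forall k, 2 ^+ N * `|D k t| <= 2 ^+ k * M k.

Let D_le k t : `|D k t| <= M k.
Proof.
by have := taylor k 0 t 0; rewrite big_ord0 subr0 addr0 addn0 expr0 fact0 divr1 mulr1.
Qed.

Let M_ge0 k : 0 <= M k. Proof. exact: le_trans (D_le k 0). Qed.

Let p_ratioX N k j : (k + j <= N)%N -> p N ^+ j * M (k + j)%N <= M k.
Proof.
elim: j => [|j IH]; first by rewrite addn0 expr0 mul1r.
rewrite addnS => kjN; apply: le_trans (IH (ltnW kjN)).
rewrite exprSr -mulrA ler_wpM2l ?exprn_ge0 ?(ltW (p_gt0 N))//.
apply: le_trans (p_ratio _).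
by rewrite ler_wpM2r// p_le.
Qed.

Let step_term N k j (s : R) : (k + j <= N)%N -> `|s| <= p N / 4 ->
  2 ^+ (k + j) * M (k + j)%N * (`|s| ^+ j / j`!%:R) <=
  2 ^+ k * M k * 2^-1 ^+ j.
Proof.
move=> kjN hs.
have h1 : `|s| ^+ j / j`!%:R <= (p N) ^+ j * (4^-1) ^+ j.
  rewrite -exprMn; apply: (@le_trans _ _ (`|s| ^+ j)).
    by rewrite ler_piMr ?exprn_ge0// invf_le1 ?ler1n ?ltr0n fact_gt0.
  by rewrite lerXn2r// nnegrE divr_ge0// ltW.
apply: (@le_trans _ _ (2 ^+ (k + j) * M (k + j)%N * (p N ^+ j * 4^-1 ^+ j))).
  by rewrite ler_wpM2l// mulr_ge0// exprn_ge0.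
have -> : 2 ^+ (k + j) * M (k + j)%N * (p N ^+ j * 4^-1 ^+ j) =
  2 ^+ k * (p N ^+ j * M (k + j)%N) * 2^-1 ^+ j.
  have -> : (4^-1 : R) = 2^-1 * 2^-1 by field.
  rewrite exprMn exprD.
  have : (2 : R) ^+ j * 2^-1 ^+ j = 1 by rewrite -exprMn divff// expr1n.
  move=> e; transitivity ((2 ^+ j * 2^-1 ^+ j) *
    (2 ^+ k * (p N ^+ j * M (k + j)%N) * 2^-1 ^+ j)); last by rewrite e mul1r.
  by ring.
rewrite ler_wpM2r ?exprn_ge0 ?invr_ge0// ler_wpM2l ?exprn_ge0//.
exact: p_ratioX.
Qed.

Let flat_step N t s : flat N.+1 t -> `|s| <= p N.+1 / 4 -> flat N (t + s).
Proof.
move=> ft hs k; have [Nk|kN] := leqP N k.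
  (* orders k >= N are covered by the a priori bound |D k| <= M k *)
  apply: ler_pM => //; by [rewrite exprn_ge0|rewrite ler_eXn2l// ltr1n].
pose m := (N.+1 - k)%N.
have km : (k + m = N.+1)%N by rewrite subnKC// ltnW// ltnW.
suff : 2 ^+ N.+1 * `|D k (t + s)| <= 2 * (2 ^+ k * M k).
  by rewrite exprS -mulrA ler_pM2l.
apply: (@le_trans _ _ (\sum_(j < m.+1) 2 ^+ k * M k * 2^-1 ^+ j)); last first.
  rewrite -mulr_sumr mulrC ler_wpM2r ?mulr_ge0 ?exprn_ge0//.
  exact: sum_half_le.
rewrite big_ord_recr/=.
have -> : D k (t + s) = \sum_(j < m) D (k + j)%N t * (s ^+ j / j`!%:R) +
  (D k (t + s) - \sum_(j < m) D (k + j)%N t * (s ^+ j / j`!%:R)).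
  by rewrite [RHS]addrC subrK.
apply: le_trans (_ : 2 ^+ N.+1 * (\sum_(j < m) `|D (k + j)%N t| * (`|s| ^+ j / j`!%:R) +
   M (k + m)%N * (`|s| ^+ m / m`!%:R)) <= _).
  rewrite ler_wpM2l ?exprn_ge0//; apply: le_trans (ler_normD _ _) _.
  apply: lerD; last exact: taylor.
  apply: le_trans (ler_norm_sum _ _ _) _; apply: ler_sum => j _.
  by rewrite !normrM normfV normrX (ger0_norm (ler0n _ _)).
rewrite mulrDr; apply: lerD; last first.
  by have := @step_term N.+1 k m s; rewrite km [X in _ -> X <= _]mulrA; exact.
rewrite mulr_sumr; apply: ler_sum => j _.
have kj : (k + j <= N.+1)%N by rewrite -km leq_add2l ltnW.
apply: le_trans (step_term kj hs).
by rewrite mulrA ler_wpM2r ?ft// mulr_ge0 ?exprn_ge0 ?invr_ge0.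
Qed.

Hypothesis D0 : forall k, D k 0 = 0.

(* Downward induction on the order: 0 is flat to every order, and moving from
   order N + d to order N permits a displacement of the sum of the steps. *)
Let flat_near d N t : `|t| <= \sum_(N <= i < N + d) p i.+1 / 4 -> flat N t.
Proof.
elim: d N t => [|d IH] N t.
  rewrite addn0 big_geq// normr_le0 => /eqP -> k.
  by rewrite D0 normr0 mulr0 mulr_ge0 ?exprn_ge0.
rewrite addnS -addSn big_ltn ?ltnS ?leq_addr//.
move=> /split_le_add[||t' [s [-> ht' hs]]].
- by rewrite divr_gt0.
- by apply: sumr_ge0 => i _; rewrite divr_ge0// ltW.
- exact/flat_step/hs/IH.
Qed.

Lemma bang_vanishing_quotients : divergent p -> forall t, D 0%N t = 0.
Proof.
move=> div t.
have flatN N : flat N t.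
  pose A := \sum_(1 <= k < N.+1) p k + 4 * `|t|.
  have [n hn] := div A.
  have Nn : `|t| <= \sum_(N.+1 <= i < n) p i / 4.
    rewrite -mulr_suml ler_pdivlMr// mulrC.
    have [nN|Nn] := leqP n N.+1.
      rewrite big_geq//; have : \sum_(1 <= k < n) p k <= \sum_(1 <= k < N.+1) p k.
        have [n0|n1] := leqP n 1.
          by rewrite big_geq// sumr_ge0// => i _; exact: ltW.
        rewrite [leRHS](@big_cat_nat _ _ _ n)//=; last exact: ltnW.
        by rewrite lerDl sumr_ge0// => i _; exact: ltW.
      by move: hn; rewrite /A; lra.
    move: hn; rewrite /A (@big_cat_nat _ _ _ N.+1 1 n)//=; last exact: ltnW.
    by rewrite lerD2l.
  apply: (@flat_near (n - N.+1)).
  case: n hn Nn => [|n] hn; first by rewrite big_geq// sub0n addn0 big_geq.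
  have [nN|Nn] := leqP n N.
    by rewrite big_geq// => /le_trans; apply; rewrite sumr_ge0// => i _; rewrite divr_ge0// ltW.
  by rewrite big_add1/= subSS subnKC// ltnW.
apply/eqP; rewrite -normr_le0 leNgt; apply/negP => Dt.
have := archi_boundP (divr_ge0 (M_ge0 0%N) (ltW Dt)).
set N := Num.bound _; rewrite ltr_pdivrMr// => hN.
have := flatN N 0%N; rewrite expr0 mul1r => /le_lt_trans/(_ hN).
rewrite ltr_pM2r// -natrX ltr_nat => /ltnW.
by rewrite leqNgt ltn_expl.
Qed.

End bang.

(** Denjoy-Carleman uniqueness, for functions D k that behave as the successive
    derivatives of D 0.  Only the Taylor inequality is assumed, so that no
    differentiation under the integral sign is needed when D k is an integral.
    Since the p_k have infinite sum, every t can be reached from 0 with any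
    prescribed flatness left, i.e. |D 0 t| <= 2^-N M 0 for all N. *)
Lemma bang_vanishing (R : realType) (D : nat -> R -> R) (M : nat -> R) :
  quasianalytic M ->
  (forall k m t s,
    `|D k (t + s) - \sum_(j < m) D (k + j)%N t * (s ^+ j / j`!%:R)| <=
    M (k + m)%N * (`|s| ^+ m / m`!%:R)) ->
  (forall k, D k 0 = 0) -> forall t, D 0%N t = 0.
Proof. by move=> [p [? ? ? ?]] tay D0; exact: bang_vanishing_quotients. Qed.

(** * Carleman's inequality and the Carleman condition *)

Section carleman_inequality.
Variables (R : realType) (p G : nat -> R).
Hypotheses (p_gt0 : forall k, 0 < p k) (G_ge0 : forall k, 0 <= G k).
Hypothesis G_le : forall k, G k ^+ k <= \prod_(1 <= j < k.+1) p j.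

(* Carleman's weights: the product of w_1, ..., w_k is (k + 1)^k, and
   w_j / j = (1 + 1/j)^j stays below e. *)
Let w j : R := j.+1%:R ^+ j / j%:R ^+ j.-1.

Let w_ge0 j : 0 <= w j. Proof. by rewrite divr_ge0// exprn_ge0. Qed.

Let prod_w k : \prod_(1 <= j < k.+1) w j = k.+1%:R ^+ k.
Proof.
elim: k => [|k IH]; first by rewrite big_geq// expr0.
by rewrite big_nat_recr//= IH /w/= mulrC divfK// expf_neq0// pnatr_eq0.
Qed.

Let x j := w j * p j.
Let S k := \sum_(1 <= j < k.+1) x j.

Let G_le_mean k : (0 < k)%N -> G k <= S k / (k%:R * k.+1%:R).
Proof.
move=> k0; have kR : 0 < k%:R :> R by rewrite ltr0n.
have k1R : 0 < k.+1%:R :> R by rewrite ltr0n.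
have x0 j : 0 <= x j by rewrite mulr_ge0// ltW.
have S0 : 0 <= S k by rewrite sumr_ge0.
rewrite invfM mulrA ler_pdivlMr//.
rewrite -(@ler_pXn2r _ k)// ?nnegrE ?mulr_ge0 ?divr_ge0 ?G_ge0//.
rewrite exprMn; apply: (@le_trans _ _ (\prod_(1 <= j < k.+1) x j)).
  rewrite big_split/= prod_w mulrC ler_wpM2l// ?exprn_ge0//.
rewrite /S !big_add1/= !big_mkord.
have E0 : {in 'I_k, forall j : 'I_k, 0 <= x j.+1 / k%:R *+ #|'I_k|}.
  by move=> j _; rewrite mulrn_wge0// divr_ge0.
have [+ _] := leif_AGM_scaled E0; rewrite -mulr_suml.
rewrite (_ : \prod_(i in _) _ = \prod_(i < k) x i.+1) ?card_ord//.
by apply: eq_bigr => i _; rewrite ?card_ord -[LHS]mulr_natr divfK// gt_eqF.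
Qed.

(* Abel summation, from 1 / (k (k + 1)) = 1 / k - 1 / (k + 1) *)
Let sum_mean n : \sum_(1 <= k < n.+1) S k / (k%:R * k.+1%:R) + S n / n.+1%:R =
  \sum_(1 <= j < n.+1) x j / j%:R.
Proof.
elim: n => [|n IH]; first by rewrite /S !big_geq// mul0r addr0.
rewrite !(@big_nat_recr _ _ _ n.+1)//= -IH.
have -> : S n.+1 = S n + x n.+1 by rewrite /S (@big_nat_recr _ _ _ n.+1).
have n1 : n.+1%:R = n%:R + 1 :> R by rewrite -natr1.
have n2 : n.+2%:R = n%:R + 2 :> R by rewrite -[n.+2]addn2 natrD.
rewrite n1 n2; have : 0 <= n%:R :> R by [].
move=> n0; field; apply/andP; split; rewrite gt_eqF//; lra.
Qed.

Let w_le j : (0 < j)%N -> w j / j%:R <= expR 1.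
Proof.
case: j => // j _; rewrite /w/= -mulrA -invfM -exprSr -expr_div_n.
have -> : j.+2%:R / j.+1%:R = 1 + j.+1%:R^-1 :> R.
  rewrite -[j.+2]addn1 natrD mulrDl divff ?pnatr_eq0// mul1r//.
rewrite [X in expR X](_ : 1 = j.+1%:R * j.+1%:R^-1); last by rewrite divff ?pnatr_eq0.
rewrite expRM_natl lerXn2r ?expR_ge1Dx// nnegrE ?expR_ge0// addr_ge0// invr_ge0//.
Qed.

(** By the arithmetic-geometric inequality applied to w_j p_j, the geometric mean
    of p_1, ..., p_k is at most the sum of the w_j p_j over j <= k divided by
    k (k + 1); summing over k leaves w_j p_j / j <= e p_j. *)
Lemma carleman_inequality n :
  \sum_(1 <= k < n.+1) G k <= expR 1 * \sum_(1 <= j < n.+1) p j.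
Proof.
apply: (@le_trans _ _ (\sum_(1 <= k < n.+1) S k / (k%:R * k.+1%:R))).
  by apply: ler_sum_nat => k /andP[k0 _]; exact: G_le_mean.
apply: (@le_trans _ _ (\sum_(1 <= j < n.+1) x j / j%:R)).
  rewrite -sum_mean lerDl divr_ge0// sumr_ge0// => j _.
  by rewrite mulr_ge0// ltW.
rewrite mulr_sumr; apply: ler_sum_nat => j /andP[j0 _].
by rewrite /x mulrAC ler_wpM2r ?w_le// ltW.
Qed.

End carleman_inequality.

Lemma nneseries_pinfty_ge (R : realType) (u : nat -> \bar R) :
  (forall k, 0 <= u k)%E -> (\sum_(1 <= k <oo) u k = +oo)%E ->
  forall A : R, exists n, (A%:E <= \sum_(1 <= k < n.+1) u k)%E.
Proof.
move=> u0 uoo A.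
have cv : cvgn (fun n => \sum_(1 <= k < n) u k)%E.
  by apply: is_cvg_nneseries.
have : (\sum_(1 <= k < n) u k)%E @[n --> \oo] --> +oo%E.
  by rewrite -uoo.
move=> /cvgeyPge/(_ A)[n _ hn]; exists n.
exact: hn (leqnSn n).
Qed.

(** Passage from roots to quotients: with p_k^2 = a_(k-1) / a_k, which decreases by
    log-convexity, the geometric mean of p_1, ..., p_k is (a_0 / a_k)^(1/2k).  If
    some a_k with k >= 1 vanishes, log-convexity makes a_1, a_2, ... all vanish. *)
Lemma carleman_quotients (R : realType) (a : nat -> R) :
  (forall k, 0 <= a k) -> (forall k, a k.+1 ^+ 2 <= a k * a k.+2) ->
  (\sum_(1 <= k <oo)
    (if a k == 0%R then +oo else (a k `^ (- (2 * k)%:R^-1))%:E))%E = +oo%E ->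
  exists p : nat -> R, [/\ forall k, 0 < p k,
    forall i j, (i <= j)%N -> p j <= p i,
    forall k, p k.+1 ^+ 2 * a k.+1 <= a k & divergent p].
Proof.
move=> a0 alog asum.
have [[k0 ak0]|apos] := pselect (exists k, a k.+1 = 0).
  have aS k : a k.+1 = 0 -> a k.+2 = 0.
    move=> ak; apply/eqP; rewrite -sqrf_eq0 eq_le sqr_ge0 andbT.
    by rewrite (le_trans (alog _))// ak mul0r.
  have a1 k : a k.+1 = 0 -> a 1%N = 0.
    elim: k => // k IH ak; apply: IH; apply/eqP.
    rewrite -sqrf_eq0 eq_le sqr_ge0 andbT.
    by rewrite (le_trans (alog _))// ak mulr0.
  have az k : a k.+1 = 0 by elim: k => [|k IH]; [exact: a1 ak0|exact: aS].
  exists (fun=> 1); split => //; first by move=> k; rewrite az mulr0.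
  move=> A; exists (Num.bound A).+1; rewrite big_add1/= sumr_const_nat subn0.
  have [A0|A0] := leP A 0; first by rewrite (le_trans A0).
  by rewrite -[1 *+ _]/(_%:R) ltW// archi_boundP// ltW.
have {}apos k : 0 < a k.
  have ap j : 0 < a j.+1.
    by rewrite lt_neqAle a0 andbT eq_sym; apply/eqP => aj; apply: apos; exists j.
  case: k => // ; rewrite lt_neqAle a0 andbT eq_sym; apply/eqP => aj.
  by have := alog 0%N; rewrite aj mul0r leNgt exprn_gt0.
pose p k := Num.sqrt (a k.-1 / a k.-1.+1).
have p0 k : 0 < p k by rewrite sqrtr_gt0 divr_gt0.
have p2 k : p k.+1 ^+ 2 = a k / a k.+1.
  by rewrite sqr_sqrtr// divr_ge0.
have pprod k : (\prod_(1 <= j < k.+1) p j) ^+ 2 = a 0%N / a k.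
  elim: k => [|k IH]; first by rewrite big_geq// expr1n divff// gt_eqF.
  rewrite big_nat_recr//= exprMn IH p2 mulrA divfK// gt_eqF//.
exists p; split => //.
- apply/nonincreasing_seqP => -[|k]; rewrite /p//= ler_sqrt ?divr_ge0//.
  by rewrite ler_pdivrMr// mulrAC ler_pdivlMr// -expr2.
- by move=> k; rewrite p2 divfK// gt_eqF.
(* C >= (a 0)^(-1/2k) for every k >= 1, whatever the position of a 0 and 1 *)
pose C := Num.max 1 (a 0%N)^-1.
have C1 : 1 <= C by rewrite le_max lexx.
have C0 : 0 < C by rewrite (lt_le_trans ltr01).
have Ca : (a 0%N)^-1 <= C by rewrite le_max lexx orbT.
pose t k := a k `^ (- (2 * k)%:R^-1).
have t0 k : 0 <= t k by exact: powR_ge0.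
have tX k : (0 < k)%N -> t k ^+ (2 * k) = (a k)^-1.
  move=> k1; rewrite -powR_mulrn// -powRrM mulNr mulVf ?powR_inv1//.
  by rewrite pnatr_eq0 muln_eq0/= -lt0n.
have GX k : (t k / C) ^+ k <= \prod_(1 <= j < k.+1) p j.
  case: k => [|k]; first by rewrite expr0 big_geq.
  have tC0 : 0 <= t k.+1 / C by rewrite divr_ge0// ltW.
  have pk0 : 0 <= \prod_(1 <= j < k.+2) p j by rewrite prodr_ge0// => j _; exact: ltW.
  rewrite -(@ler_pXn2r _ 2)// ?nnegrE ?exprn_ge0//.
  rewrite pprod -exprM mulnC exprMn tX// mulrC ler_wpM2r ?invr_ge0//.
  rewrite exprVn -[leRHS]invrK lef_pV2 ?posrE ?exprn_gt0 ?invr_gt0//.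
  by rewrite (le_trans Ca)// ler_eXnr.
have u0 k : (0 <= if a k == 0%R then +oo else (t k)%:E)%E.
  by case: ifPn => // _; rewrite lee_fin.
move=> A.
have [n] := @nneseries_pinfty_ge _ _ u0 asum (A * (expR 1 * C)).
under eq_bigr do rewrite gt_eqF//.
rewrite sumEFin lee_fin => hn; exists n.+1.
have eC : 0 < expR 1 * C by rewrite mulr_gt0// expR_gt0.
rewrite -(ler_pM2r eC) (le_trans hn)//.
have G0 k : 0 <= t k / C by rewrite divr_ge0// ltW.
have := carleman_inequality p0 G0 GX n.
rewrite -mulr_suml ler_pdivrMr// => /le_trans; apply.
by rewrite mulrAC mulrC.
Qed.


(** * Taylor inequality for the cosine *)

Lemma ler_norm_derive_ge0 (R : realType) (f df g dg : R -> R) :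
  (forall x : R, is_derive x 1 f (df x)) -> (forall x : R, is_derive x 1 g (dg x)) ->
  f 0 = 0 -> g 0 = 0 -> (forall x, 0 <= x -> `|df x| <= dg x) ->
  forall x, 0 <= x -> `|f x| <= g x.
Proof.
move=> dF dG f0 g0 dfg x x0.
have H (h dh : R -> R) : (forall x : R, is_derive x 1 h (dh x)) -> h 0 = 0 ->
    (forall x, 0 <= x -> 0 <= dh x) -> 0 <= h x.
  move=> dH h0 dh0; rewrite -h0.
  apply: (@ger0_derive1_ndecr _ h 0 x) => //.
  - move=> y; rewrite in_itv/= => /andP[/ltW y0 _].
    by rewrite derive1E (@derive_val _ _ _ _ _ _ _ (dH y)) dh0.
  - apply: derivable_within_continuous => y _.
    by have [] := dH y.
have P := H (g - f) (fun x => dg x - df x).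
have N := H (g + f) (fun x => dg x + df x).
rewrite ler_norml; apply/andP; split.
- have : 0 <= (g + f) x.
    apply: (N (fun y => is_deriveD (dG y) (dF y))).
      by change (g 0 + f 0 = 0); rewrite f0 g0 addr0.
    by move=> y /dfg; rewrite ler_norml => /andP[]; lra.
  by change (0 <= g x + f x -> - g x <= f x); lra.
- have : 0 <= (g - f) x.
    apply: (P (fun y => is_deriveB (dG y) (dF y))).
      by change (g 0 - f 0 = 0); rewrite f0 g0 subr0.
    by move=> y /dfg; rewrite ler_norml => /andP[]; lra.
  by change (0 <= g x - f x -> f x <= g x); lra.
Qed.

Section cos_taylor.
Variable R : realType.

Let cs (th : R) (j : nat) := cos (th + j%:R * (pi / 2)).
Let P m th : {poly R} := \poly_(j < m) (cs th j / j`!%:R).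
Let dP m th : (P m.+1 th)^`() = P m (th + pi / 2).
Proof.
apply/polyP => j; rewrite coef_deriv !coef_poly ltnS; case: ifP => // _; last exact: mul0rn.
rewrite /cs factS natrM -[LHS]mulr_natl.
have -> : th + pi / 2 + j%:R * (pi / 2) = th + j.+1%:R * (pi / 2) :> R.
  by rewrite -natr1; ring.
by rewrite invfM mulrCA; rewrite mulVKf ?pnatr_eq0.
Qed.

Let dcos (th x : R) : is_derive x 1 (fun s => cos (th + s)) (cos (th + pi / 2 + x)).
Proof.
have -> : cos (th + pi / 2 + x) = - sin (th + x).
  by rewrite addrAC cosDpihalf.
rewrite (_ : (fun s => _) = cos \o (+%R th))//.
have d1 : is_derive x 1 (+%R th) 1.
  rewrite (_ : +%R th = cst th + id :> (R -> R))//.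
  by apply: is_derive_eq; rewrite add0r.
by have := @is_derive1_comp _ cos (+%R th) x _ _ (is_derive_cos _) d1; rewrite mulr1.
Qed.

(** The j-th derivative of cos is a shifted cos, so the remainder of order m + 1
    has the remainder of order m as derivative. *)
Lemma cos_taylor (th s : R) (m : nat) :
  `|cos (th + s) - \sum_(j < m) cos (th + j%:R * (pi / 2)) * (s ^+ j / j`!%:R)|
    <= `|s| ^+ m / m`!%:R.
Proof.
suff H : `|cos (th + s) - (P m th).[s]| <= `|s| ^+ m / m`!%:R.
  move: H; rewrite /P horner_poly.
  by under eq_bigr do rewrite mulrAC -mulrA.
elim: m th s => [|m IH] th s.
  by rewrite /P poly_def big_ord0 horner0 subr0 expr0 fact0 divr1 cos_max.
pose f s := cos (th + s) - (P m.+1 th).[s].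
pose df s := cos (th + pi / 2 + s) - (P m (th + pi / 2)).[s].
have dF (x : R) : is_derive x 1 f (df x).
  rewrite /df -dP; apply: is_deriveB; first exact: dcos.
pose g s : R := s ^+ m.+1 / (m.+1)`!%:R.
pose dg s : R := s ^+ m / m`!%:R.
have dG (x : R) : is_derive x 1 g (dg x).
  rewrite (_ : g = (m.+1)`!%:R^-1 *: (id ^+ m.+1 : R -> R)); last first.
    apply/funext => y; rewrite /g mulrC.
    change ((m.+1)`!%:R^-1 * y ^+ m.+1 = (m.+1)`!%:R^-1 * ((id : R -> R) ^+ m.+1) y).
    by rewrite exprfctE.
  apply: is_derive_eq.
  rewrite /= /dg factS natrM invfM scalerA.
  rewrite /GRing.scale/= mulr1 mulrACA mulVf ?pnatr_eq0// mul1r mulrC//.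
have f0 : f 0 = 0.
  rewrite /f addr0 horner_coef0 /P coef_poly/= /cs mul0r addr0 fact0 divr1 subrr//.
have g0 : g 0 = 0 by rewrite /g exprS mul0r mul0r.
have [s0|s0] := leP 0 s.
  rewrite (ger0_norm s0); apply: (ler_norm_derive_ge0 dF dG) => // x x0.
  by rewrite /dg -{2}(ger0_norm x0); exact: IH.
have dFN (x : R) : is_derive x 1 (f \o -%R) (- df (- x)).
  have := @is_derive1_comp _ f -%R x _ _ (dF (- x)) (is_deriveNid _ _).
  by rewrite mulrN1.
have fN0 : (f \o -%R) 0 = 0 by rewrite /= oppr0.
have bound (x : R) : 0 <= x -> `|- df (- x)| <= dg x.
  move=> x0; rewrite normrN /dg -[in leRHS](ger0_norm x0) -[`|x|]normrN.
  exact: IH.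
have sN : 0 <= - s by rewrite oppr_ge0 ltW.
have := ler_norm_derive_ge0 dFN dG fN0 g0 bound sN.
rewrite /= opprK /g (ltr0_norm s0).
exact.
Qed.

End cos_taylor.

(** * Integrals of real-valued functions *)

Section integrals.
Context d (T : measurableType d) (R : realType) (mu : {measure set T -> \bar R}).
Implicit Types f g c : T -> R.

Definition integ f := mu.-integrable [set: T] (EFin \o f).

Lemma integ_measurable f : integ f -> measurable_fun setT f.
Proof. by move=> /measurable_int/measurable_EFinP. Qed.

Lemma integ_le f g : measurable_fun setT f -> (forall x, `|f x| <= g x) ->
  integ g -> integ f.
Proof.
move=> mf fg; apply: le_integrable => //; first exact/measurable_EFinP.
by move=> x _; rewrite /= lee_fin (le_trans (fg x))// ler_norm.
Qed.

Lemma integ_norm f : integ f -> integ (fun x => `|f x|).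
Proof. exact: integrable_norm. Qed.

Lemma integD f g : integ f -> integ g -> integ (fun x => f x + g x).
Proof. by move=> fi gi; exact: (integrableD measurableT fi gi). Qed.

Lemma integB f g : integ f -> integ g -> integ (fun x => f x - g x).
Proof. by move=> fi gi; exact: (integrableB measurableT fi gi). Qed.

Lemma integZ (k : R) f : integ f -> integ (fun x => k * f x).
Proof. by move=> fi; exact: (integrableZl measurableT k fi). Qed.

Lemma integ0 : integ (fun=> 0).
Proof. exact: integrable0. Qed.

Lemma integ_sum m (f : nat -> T -> R) : (forall j, integ (f j)) ->
  integ (fun x => \sum_(j < m) f j x).
Proof.
move=> fi; elim: m => [|m IH].
  by under eq_fun do rewrite big_ord0; exact: integ0.
by under eq_fun do rewrite big_ord_recr/=; exact: integD.
Qed.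

Lemma integM_bounded f c : integ f -> measurable_fun setT c ->
  (forall x, `|c x| <= 1) -> integ (fun x => f x * c x).
Proof.
move=> fi mc c1; apply: (@integ_le _ (fun x => `|f x|)).
- by apply: measurable_funM => //; exact: integ_measurable.
- by move=> x; rewrite normrM ler_piMr.
- exact: integ_norm.
Qed.

Lemma IntD f g : integ f -> integ g ->
  \int[mu]_x (f x + g x) = \int[mu]_x f x + \int[mu]_x g x.
Proof. by move=> fi gi; rewrite RintegralD. Qed.

Lemma IntB f g : integ f -> integ g ->
  \int[mu]_x (f x - g x) = \int[mu]_x f x - \int[mu]_x g x.
Proof. by move=> fi gi; rewrite RintegralB. Qed.

Lemma IntZ (k : R) f : integ f -> \int[mu]_x (k * f x) = k * \int[mu]_x f x.
Proof. by move=> fi; rewrite RintegralZl. Qed.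

Lemma Int0 : \int[mu]_x (0 : R) = 0.
Proof. by rewrite Rintegral_cst// mul0r. Qed.

Lemma Int_sum m (f : nat -> T -> R) : (forall j, integ (f j)) ->
  \int[mu]_x (\sum_(j < m) f j x) = \sum_(j < m) \int[mu]_x f j x.
Proof.
move=> fi; elim: m => [|m IH].
  by under eq_Rintegral do rewrite big_ord0; rewrite big_ord0 Int0.
under eq_Rintegral do rewrite big_ord_recr/=.
by rewrite IntD ?IH ?big_ord_recr//; exact: integ_sum.
Qed.

Lemma Int_le f g : integ f -> integ g -> (forall x, f x <= g x) ->
  \int[mu]_x f x <= \int[mu]_x g x.
Proof. by move=> fi gi fg; exact: le_Rintegral. Qed.

Lemma Int_norm_le f : integ f -> `|\int[mu]_x f x| <= \int[mu]_x `|f x|.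
Proof. by move=> fi; exact: le_normr_Rintegral. Qed.

Lemma Int_ge0 f : (forall x, 0 <= f x) -> 0 <= \int[mu]_x f x.
Proof. by move=> f0; exact: Rintegral_ge0. Qed.

Lemma Int_EFin f : integ f -> (\int[mu]_x (f x)%:E)%E = (\int[mu]_x f x)%:E.
Proof. by move=> fi; rewrite /Rintegral fineK//; exact: integrable_fin_num. Qed.

Lemma Int_cvg_dominated (f_ : nat -> T -> R) f g :
  (forall n, measurable_fun setT (f_ n)) -> measurable_fun setT f ->
  {ae mu, forall x, f_ ^~ x @ \oo --> f x} -> integ g ->
  (forall n x, `|f_ n x| <= g x) ->
  \int[mu]_x f_ n x @[n --> \oo] --> \int[mu]_x f x.
Proof.
move=> mf_ mf f_f gi fg.
have f_fE : {ae mu, forall x, setT x -> (f_ n x)%:E @[n --> \oo] --> (f x)%:E}.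
  by apply: filterS f_f => x h _; apply: cvg_EFin => //; exact: nearW.
have f_g : {ae mu, forall x n, setT x -> (`|(f_ n x)%:E| <= (g x)%:E)%E}.
  by apply: aeW => x n _; rewrite lee_fin.
have [||fi _ H] := dominated_convergence measurableT _ _ f_fE gi f_g.
- by move=> n; exact/measurable_EFinP.
- exact/measurable_EFinP.
move: H; rewrite (Int_EFin fi) => /fine_cvgP[_]; exact.
Qed.

End integrals.

(** * Measures on the line with vanishing moments *)

Section cosine_transform.
Context d (T : measurableType d) (R : realType) (mu : {measure set T -> \bar R}).
Variables (h u : T -> R) (M : nat -> R).
Hypotheses (mu_u : measurable_fun setT u)
  (hu_integ : forall k, integ mu (fun x => h x * u x ^+ k))
  (hu_eq0 : forall k, \int[mu]_x (h x * u x ^+ k) = 0)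
  (hu_le : forall k, \int[mu]_x `|h x * u x ^+ k| <= M k).

Let measurable_cos_affine (t b : R) : measurable_fun setT (fun x => cos (t * u x + b)).
Proof.
have mc : measurable_fun setT (@cos R).
  by apply: continuous_measurable_fun; exact: continuous_cos.
apply: (measurableT_comp mc).
by apply: measurable_funD => //; apply: measurable_funM.
Qed.

Let integ_cos k (t b : R) : integ mu (fun x => h x * u x ^+ k * cos (t * u x + b)).
Proof. by apply: integM_bounded => // x; exact: cos_max. Qed.

(** The functions D k below are the derivatives of the cosine transform; at t = 0
    they are multiples of moments. *)
Lemma cosine_transform_eq0 : quasianalytic M ->
  forall t b, \int[mu]_x (h x * cos (t * u x + b)) = 0.
Proof.
move=> qaM t b.
pose D k t := \int[mu]_x (h x * u x ^+ k * cos (t * u x + (b + k%:R * (pi / 2)))).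
have D0 k : D k 0 = 0.
  rewrite /D; under eq_Rintegral do rewrite mul0r add0r mulrC.
  by rewrite IntZ// hu_eq0 mulr0.
suff taylor k m t' s :
    `|D k (t' + s) - \sum_(j < m) D (k + j)%N t' * (s ^+ j / j`!%:R)| <=
    M (k + m)%N * (`|s| ^+ m / m`!%:R).
  have := bang_vanishing qaM taylor D0 t; rewrite /D => <-.
  by apply: eq_Rintegral => x _; rewrite expr0 mulr1 mul0r addr0.
pose F j x := (s ^+ j / j`!%:R) *
  (h x * u x ^+ (k + j) * cos (t' * u x + (b + (k + j)%:R * (pi / 2)))).
have FI j : integ mu (F j) by apply: integZ; exact: integ_cos.
have -> : D k (t' + s) - \sum_(j < m) D (k + j)%N t' * (s ^+ j / j`!%:R) =
  \int[mu]_x (h x * u x ^+ k * cos ((t' + s) * u x + (b + k%:R * (pi / 2))) -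
    \sum_(j < m) F j x).
  rewrite IntB//; last exact: integ_sum.
  rewrite Int_sum//; congr (_ - _); apply: eq_bigr => j _.
  by rewrite IntZ; [rewrite mulrC|exact: integ_cos].
apply: le_trans (Int_norm_le _) _; first by apply: integB => //; exact: integ_sum.
have c0 : 0 <= `|s| ^+ m / m`!%:R by rewrite divr_ge0// exprn_ge0.
apply: (@le_trans _ _ (\int[mu]_x (`|s| ^+ m / m`!%:R * `|h x * u x ^+ (k + m)|))).
  apply: Int_le.
  - by apply: integ_norm; apply: integB => //; exact: integ_sum.
  - by apply: integZ; exact: integ_norm.
  move=> x.
  pose th := t' * u x + (b + k%:R * (pi / 2)).
  have -> : h x * u x ^+ k * cos ((t' + s) * u x + (b + k%:R * (pi / 2))) -
      \sum_(j < m) F j x = h x * u x ^+ k * (cos (th + s * u x) -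
      \sum_(j < m) cos (th + j%:R * (pi / 2)) * ((s * u x) ^+ j / j`!%:R)).
    rewrite mulrBr mulr_sumr; congr (_ - _).
      by congr (_ * cos _); rewrite /th; ring.
    apply: eq_bigr => j _; rewrite /F exprMn exprD natrD.
    have -> : t' * u x + (b + (k%:R + j%:R) * (pi / 2)) = th + j%:R * (pi / 2).
      by rewrite /th; ring.
    by ring.
  rewrite normrM.
  apply: le_trans (ler_wpM2l (normr_ge0 _) (cos_taylor _ _ _)) _.
  by rewrite exprD !normrM exprMn !normrX le_eqVlt; apply/orP; left; apply/eqP; ring.
rewrite IntZ; last exact: integ_norm.
by rewrite mulrC ler_wpM2r.
Qed.

End cosine_transform.

(** Linear combinations of t |-> cos (t x + b) with arbitrary frequencies; the
    phase b makes sines superfluous. *)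
Inductive trigpoly (R : realType) : (R -> R) -> Prop :=
| trigpoly_cos t b : trigpoly (fun x => cos (t * x + b))
| trigpolyD f g : trigpoly f -> trigpoly g -> trigpoly (fun x => f x + g x)
| trigpolyZ c f : trigpoly f -> trigpoly (fun x => c * f x).

Section trigpoly.
Variable R : realType.
Implicit Types f g : R -> R.

Lemma trigpolyM f g : trigpoly f -> trigpoly g -> trigpoly (fun x => f x * g x).
Proof.
move=> + tg; elim=> [t b|f1 f2 _ IH1 _ IH2|c f1 _ IH1].
- elim: tg => [t' b'|f1 f2 _ IH1 _ IH2|c f1 _ IH1].
  + rewrite (_ : (fun x => _) = fun x => 2^-1 * (cos ((t + t') * x + (b + b')) +
      cos ((t - t') * x + (b - b')))).
      by apply/trigpolyZ/trigpolyD; exact: trigpoly_cos.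
    apply/funext => x.
    have -> : (t + t') * x + (b + b') = (t * x + b) + (t' * x + b') by ring.
    have -> : (t - t') * x + (b - b') = (t * x + b) - (t' * x + b') by ring.
    by move: (t * x + b) (t' * x + b') => A B; rewrite cosD cosB; field.
  + by under eq_fun do rewrite mulrDr; exact: trigpolyD.
  + by under eq_fun do rewrite mulrCA; exact: trigpolyZ.
- by under eq_fun do rewrite mulrDl; exact: trigpolyD.
- by under eq_fun do rewrite -mulrA; exact: trigpolyZ.
Qed.

Lemma continuous_trigpoly f : trigpoly f -> continuous f.
Proof.
elim=> [t b|f1 f2 _ IH1 _ IH2|c f1 _ IH1] x.
- apply: (@continuous_comp _ _ _ (fun x => t * x + b) cos); last exact: continuous_cos.
  by apply: cvgD; [apply: cvgM; [exact: cvg_cst|exact: cvg_id]|exact: cvg_cst].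
- by apply: cvgD; [exact: IH1|exact: IH2].
- by apply: cvgM; [exact: cvg_cst|exact: IH1].
Qed.

(** The polynomial (3 s - s^3) / 2, whose iterates tend to the sign on [-1, 1]; it
    is written with products because [trigpoly] is closed under them. *)
Definition sharpen (s : R) : R := 2^-1 * (3 * s - s * (s * s)).

Lemma sharpenN s : sharpen (- s) = - sharpen s.
Proof. by rewrite /sharpen; ring. Qed.

Lemma trigpoly_sharpen m f : trigpoly f -> trigpoly (fun x => iter m sharpen (f x)).
Proof.
move=> tf; elim: m => [|m IH]//=; apply: trigpolyZ.
rewrite (_ : (fun x => _) = fun x => 3 * iter m sharpen (f x) +
  -1 * (iter m sharpen (f x) * (iter m sharpen (f x) * iter m sharpen (f x)))).
  by apply: trigpolyD; apply: trigpolyZ => //; do 2 apply: trigpolyM => //.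
by apply/funext => x; ring.
Qed.

(** 1 is a fixed point and 1 - sharpen y = (1 - y) ((1 - y) (2 + y) / 2), where the
    last factor is at most 1 - y / 2 <= 1 - s / 2 as long as y >= s. *)
Lemma iter_sharpen_bounds m s : 0 <= s <= 1 ->
  s <= iter m sharpen s <= 1 /\ 1 - iter m sharpen s <= (1 - s / 2) ^+ m.
Proof.
move=> /andP[s0 s1]; elim: m => [|m [/andP[IH1 IH2] IH3]].
  by rewrite /= lexx s1 expr0 lerBlDr lerDl.
rewrite iterS; move: IH1 IH2 IH3; set y := iter m _ _ => sy y1 yX.
have e1 : 1 - sharpen y = (1 - y) * ((1 - y) * (2 + y) / 2).
  by rewrite /sharpen; field.
have e2 : sharpen y - y = y * ((1 - y) * (1 + y)) / 2.
  by rewrite /sharpen; field.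
have y0 : 0 <= y by lra.
have p1 : 0 <= 1 - sharpen y.
  by rewrite e1 mulr_ge0 ?subr_ge0// divr_ge0// mulr_ge0//; lra.
have p2 : 0 <= sharpen y - y.
  by rewrite e2 divr_ge0// !mulr_ge0//; lra.
split; first by apply/andP; split; lra.
rewrite e1 exprSr; apply: ler_pM => //; first by lra.
  by rewrite divr_ge0// mulr_ge0//; lra.
have yy : 0 <= y * y by rewrite mulr_ge0.
suff -> : (1 - y) * (2 + y) / 2 = 1 - y / 2 - y * y / 2 by lra.
by field.
Qed.

Lemma iter_sharpen_le1 m s : `|s| <= 1 -> `|iter m sharpen s| <= 1.
Proof.
have iterN r : iter m sharpen (- r) = - iter m sharpen r.
  by elim: m => //= m ->; rewrite sharpenN.
wlog s0 : s / 0 <= s.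
  move=> H; have [s0|/ltW s0] := leP 0 s; first exact: H.
  by rewrite -normrN => /H; rewrite iterN normrN; apply; rewrite oppr_ge0.
rewrite ger0_norm// => s1; have [] := @iter_sharpen_bounds m s.
  by rewrite s0 s1.
by move=> /andP[h1 h2] _; rewrite ger0_norm// (le_trans s0).
Qed.

Lemma iter_sharpen_cvg s : `|s| <= 1 -> iter m sharpen s @[m --> \oo] --> Num.sg s.
Proof.
have iterN m r : iter m sharpen (- r) = - iter m sharpen r.
  by elim: m => //= m ->; rewrite sharpenN.
wlog s0 : s / 0 <= s.
  move=> H; have [s0|/ltW s0] := leP 0 s; first exact: H.
  rewrite -normrN => /H; rewrite oppr_ge0 => /(_ s0) /cvgN.
  rewrite sgrN opprK; apply: cvg_trans; apply: near_eq_cvg.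
  by apply: nearW => m /=; rewrite fctE/= iterN opprK.
rewrite ger0_norm// => s1.
move: s0; rewrite le_eqVlt => /predU1P[<-|s0].
  rewrite sgr0 (_ : (fun m => _) = cst 0); first exact: cvg_cst.
  by apply/funext => m; elim: m => //= m ->; rewrite /sharpen; ring.
rewrite gtr0_sg//.
have r0 : `|1 - s / 2| < 1 by rewrite ger0_norm; lra.
have H : (1 - (1 - s / 2) ^+ m) @[m --> \oo] --> (1 : R).
  rewrite -[X in _ --> X]subr0; apply: cvgB; first exact: cvg_cst.
  exact: cvg_expr.
apply: (squeeze_cvgr _ H (@cvg_cst _ _ _ _ _)).
apply: nearW => m; have [] := @iter_sharpen_bounds m s; first by rewrite (ltW s0) s1.
by move=> /andP[h1 h2] h3; rewrite h2 andbT; lra.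
Qed.

End trigpoly.


Section halfline.
Context d (T : measurableType d) (R : realType) (mu : {measure set T -> \bar R}).
Variables (h u : T -> R).
Hypotheses (mu_u : measurable_fun setT u) (h_integ : integ mu h)
  (h_cos : forall t b, \int[mu]_x (h x * cos (t * u x + b)) = 0).

Let measurable_trigpoly f : trigpoly f -> measurable_fun setT (fun x => f (u x)).
Proof.
move=> tf; apply: (@measurableT_comp _ _ _ _ _ _ f) => //.
by apply: continuous_measurable_fun; exact: continuous_trigpoly.
Qed.

Let trigpoly_Int0 f : trigpoly f ->
  integ mu (fun x => h x * f (u x)) /\ \int[mu]_x (h x * f (u x)) = 0.
Proof.
move=> tf; elim: (tf) => [t b|f1 f2 _ [i1 e1] _ [i2 e2]|c f1 _ [i1 e1]].
- split => //; apply: integM_bounded => // [|x]; last exact: cos_max.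
  exact: (measurable_trigpoly (trigpoly_cos t b)).
- split; first by under eq_fun do rewrite mulrDr; exact: integD.
  by under eq_Rintegral do rewrite mulrDr; rewrite IntD// e1 e2 addr0.
- split; first by under eq_fun do rewrite mulrCA; exact: integZ.
  by under eq_Rintegral do rewrite mulrCA; rewrite IntZ// e1 mulr0.
Qed.

Let Int0_lim (f_ : nat -> T -> R) (f : T -> R) :
  (forall n, measurable_fun setT (f_ n)) -> (forall n x, `|f_ n x| <= 1) ->
  (forall n, \int[mu]_x (h x * f_ n x) = 0) ->
  (forall x, f_ ^~ x @ \oo --> f x) ->
  measurable_fun setT f /\ \int[mu]_x (h x * f x) = 0.
Proof.
move=> mf f1 f0 ff.
have mlim : measurable_fun setT f.
  by apply: (@measurable_fun_cvg _ _ _ setT f_) => // x _; exact: ff.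
split => //; have mh := integ_measurable h_integ.
have H : \int[mu]_x (h x * f_ n x) @[n --> \oo] --> \int[mu]_x (h x * f x).
  apply: (@Int_cvg_dominated _ _ _ _ _ _ (fun x => `|h x|)).
  - by move=> n; exact: measurable_funM.
  - exact: measurable_funM.
  - by apply: aeW => x; apply: cvgM; [exact: cvg_cst|exact: ff].
  - exact: integ_norm.
  - by move=> n x; rewrite normrM ler_piMr.
apply: (cvg_unique _ H) => //.
rewrite (_ : (fun n => _) = cst 0); first exact: cvg_cst.
exact/funext.
Qed.

(* (sg + sg^2) / 2 is the indicator of the positive reals *)
Let pos_sharpen m (s : R) := 2^-1 * (iter m (@sharpen R) s +
  iter m (@sharpen R) s * iter m (@sharpen R) s).

Let pos_sharpen_le1 m (s : R) : `|s| <= 1 -> `|pos_sharpen m s| <= 1.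
Proof.
move=> /(iter_sharpen_le1 m); rewrite /pos_sharpen; move: (iter _ _ _) => y y1.
rewrite normrM ger0_norm ?invr_ge0// ler_pdivrMl// mulr1.
have -> : 2 = 1 + 1 :> R by [].
apply: le_trans (ler_normD _ _) _; apply: lerD => //.
by rewrite normrM mulr_ile1.
Qed.

Let pos_sharpen_cvg (s : R) : `|s| <= 1 ->
  pos_sharpen m s @[m --> \oo] --> ((0 < s)%R%:R : R).
Proof.
move=> s1; have H := iter_sharpen_cvg s1.
rewrite (_ : (0 < s)%R%:R = 2^-1 * (Num.sg s + Num.sg s * Num.sg s) :> R).
  by apply: cvgM; [exact: cvg_cst|apply: cvgD => //; exact: cvgM].
by case: sgrP => // _; rewrite ?(mulr0,addr0,mulr1,mulrNN,addNr)// mulVf.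
Qed.

(** sin ((x - a) / r) has the sign of x - a once r is large; so the indicator of
    ]a, +oo[ is a bounded double limit of trigonometric polynomials, first by
    sharpening the sine to its sign and then by letting r grow. *)
Lemma halfline_Int0 a : \int[mu]_x (h x * (a < u x)%R%:R) = 0.
Proof.
pose w n x := sin (n.+1%:R^-1 * (x - a)) : R.
have w1 n x : `|w n x| <= 1 by exact: sin_max.
have tw n : trigpoly (w n).
  rewrite (_ : w n = fun x => cos (n.+1%:R^-1 * x + (- (n.+1%:R^-1 * a) - pi / 2))).
    exact: trigpoly_cos.
  by apply/funext => x; rewrite addrA cosBpihalf /w mulrBr.
have ts n m : trigpoly (fun x => pos_sharpen m (w n x)).
  apply: trigpolyZ; apply: trigpolyD; first exact: trigpoly_sharpen.
  by apply: trigpolyM; exact: trigpoly_sharpen.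
have step1 n : measurable_fun setT (fun x => (0 < w n (u x))%R%:R : R) /\
    \int[mu]_x (h x * (0 < w n (u x))%R%:R) = 0.
  apply: (@Int0_lim (fun m x => pos_sharpen m (w n (u x)))).
  - by move=> m; exact: (measurable_trigpoly (ts n m)).
  - by move=> m x; exact: pos_sharpen_le1.
  - by move=> m; have [] := trigpoly_Int0 (ts n m).
  - by move=> x; exact: pos_sharpen_cvg.
apply: (@Int0_lim (fun n x => (0 < w n (u x))%R%:R) _ _ _ _ _).2.
- by move=> n; have [] := step1 n.
- by move=> n x; case: (0 < _)%R; rewrite ?normr1 ?normr0.
- by move=> n; have [] := step1 n.
move=> x; have [->|xa] := eqVneq (u x) a.
  rewrite ltxx (_ : (fun n => _) = cst 0); first exact: cvg_cst.
  by apply/funext => n; rewrite /w subrr mulr0 sin0 ltxx.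
apply: cvg_near_cst.
exists (Num.bound (`|u x - a| / pi)) => // n /= nb.
have n0 : 0 < n.+1%:R :> R by [].
have small : n.+1%:R^-1 * `|u x - a| < pi.
  rewrite mulrC ltr_pdivrMr// mulrC -ltr_pdivrMr ?pi_gt0//.
  apply: lt_trans (archi_boundP _) _; first by rewrite divr_ge0// pi_ge0.
  by rewrite ltr_nat ltnS.
have [ax|ax] := ltP a (u x).
  rewrite /w sin_gt0_pi// mulr_gt0 ?invr_gt0 ?subr_gt0//=.
  by rewrite -(@gtr0_norm _ (u x - a)) ?subr_gt0.
have {xa}ax : u x < a by rewrite lt_neqAle xa.
rewrite /w -[u x - a]opprB mulrN sinN oppr_gt0 ltNge ltW//= sin_gt0_pi//.
rewrite mulr_gt0 ?invr_gt0 ?subr_gt0//=.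
by rewrite -(@gtr0_norm _ (a - u x)) ?subr_gt0// distrC.
Qed.

End halfline.

(** * Uniqueness in several variables *)

Section determinacy.
Context (R : realType) (n : nat) (mu : {measure set (n.-tuple R) -> \bar R}).
Local Notation T := (n.-tuple R).

Lemma measurable_monomial a : measurable_fun setT (@monomial R n a).
Proof.
apply: measurable_prod => i _; apply: measurable_funX.
exact: measurable_tnth.
Qed.

Lemma monomialMX a (i : 'I_n) k (x : T) :
  monomial a x * tnth x i ^+ k =
  monomial (mpoly.mnm_add a (mpoly.mnm_muln (mpoly.mnm1 i) k)) x.
Proof.
rewrite /monomial (bigD1 i)//= [RHS](bigD1 i)//= mulrAC -exprD.
rewrite mpoly.mnmDE mpoly.mulmnE mpoly.mnm1E eqxx mul1n; congr (_ * _).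
apply: eq_bigr => j ji.
by rewrite mpoly.mnmDE mpoly.mulmnE mpoly.mnm1E eq_sym (negPf ji) mul0n addn0.
Qed.

Lemma monomial0 (x : T) : monomial (@mpoly.mnm0 n) x = 1.
Proof. by rewrite /monomial big1// => i _; rewrite mpoly.mnm0E expr0. Qed.

(** Lists of bounds, rather than one bound per coordinate, make these sets stable
    under intersection by concatenation and include the whole space. *)
Definition above (s : seq ('I_n * R)) (x : T) := all (fun c => c.2 < tnth x c.1) s.

Let measurable_above s : measurable_fun setT (fun x => (above s x)%:R : R).
Proof.
elim: s => [|[i a] s IH]; first exact: measurable_cst.
rewrite (_ : (fun x : T => _) = fun x : T => (a < tnth x i)%R%:R * (above s x)%:R).
  apply: measurable_funM => //.
  rewrite (_ : (fun x => _) = \1_((fun x : T => tnth x i) @^-1` `]a, +oo[%classic)).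
    apply: measurable_indic; rewrite -[X in measurable X]setTI.
    exact: measurable_tnth.
  apply/funext => x; rewrite indicE; congr (_%:R); congr nat_of_bool.
  by apply/idP/idP; rewrite inE/= in_itv/= andbT.
by apply/funext => x; rewrite /above/=; case: (a < _)%R; rewrite ?mul1r ?mul0r.
Qed.

Lemma sigma_algebra_above : @measurable _ T =
  <<s [set B | exists s, B = [set x | above s x]] >>.
Proof.
set G := [set B | _]; apply/seteqP; split; last first.
  apply: smallest_sub; first exact: sigma_algebra_measurable.
  move=> _ [s ->]; have := @measurable_above s measurableT _ (measurable_set1 1).
  rewrite setTI; congr measurable; apply/seteqP; split => x /=.
    by case: above => // /esym/eqP; rewrite oner_eq0.
  by move=> ->.
apply: smallest_sub; first exact: smallest_sigma_algebra.
move=> B; rewrite -bigcup_seq => -[i /= _] [C mC <-]; rewrite setTI.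
suff : measurable_fun [set: g_sigma_algebraType G] (fun x : T => tnth x i).
  by move=> /(_ measurableT C mC); rewrite setTI.
apply: (measurability _ (RGenOInfty.measurableE R)) => _ [_ [a ->]] <-.
apply: sub_sigma_algebra; exists [:: (i, a)]; rewrite setTI.
by apply/seteqP; split => x /=; rewrite in_itv/= !andbT.
Qed.

Variable G : T -> R.
Hypotheses (G_integ : forall a, integ mu (fun x => G x * monomial a x))
  (G_eq0 : forall a, \int[mu]_x (G x * monomial a x) = 0)
  (G_qa : forall a i, exists2 M, quasianalytic M &
     forall k, \int[mu]_x `|G x * monomial a x * tnth x i ^+ k| <= M k).

(* Each new bound restricts one coordinate; the monomial is kept arbitrary since the
   one-variable statement needs all the powers of that coordinate. *)
Let Int0_above s a : \int[mu]_x (G x * monomial a x * (above s x)%:R) = 0.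
Proof.
elim: s a => [|[i r] s IH] a; first by under eq_Rintegral do rewrite mulr1.
pose h x := G x * monomial a x * (above s x)%:R.
have above1 x : `|(above s x)%:R : R| <= 1.
  by case: above; rewrite ?normr1 ?normr0.
have hE k : (fun x => h x * tnth x i ^+ k) = (fun x => G x *
    monomial (mpoly.mnm_add a (mpoly.mnm_muln (mpoly.mnm1 i) k)) x * (above s x)%:R).
  by apply/funext => x; rewrite -monomialMX /h mulrAC !mulrA.
have hi k : integ mu (fun x => h x * tnth x i ^+ k).
  by rewrite hE; exact: integM_bounded.
have h0 k : \int[mu]_x (h x * tnth x i ^+ k) = 0 by rewrite hE IH.
have [M qaM hM] := G_qa a i.
have hM' k : \int[mu]_x `|h x * tnth x i ^+ k| <= M k.
  apply: le_trans (hM k); apply: Int_le.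
  - exact: integ_norm.
  - apply: integ_norm.
    by under eq_fun do rewrite -mulrA monomialMX; exact: G_integ.
  move=> x; rewrite /h mulrAC normrM ler_piMr//.
have mt := @measurable_tnth _ R n i.
have h1 : integ mu h by have := hi 0%N; under eq_fun do rewrite expr0 mulr1.
have H := halfline_Int0 mt h1 (cosine_transform_eq0 mt hi h0 hM' qaM) r.
rewrite -[RHS]H; apply: eq_Rintegral => x _; rewrite /h /above/=.
by rewrite -mulnb natrM; ring.
Qed.

Lemma moments_eq0_ae_eq0 : {ae mu, forall x, G x = 0}.
Proof.
have Gi : integ mu G.
  by have := G_integ mpoly.mnm0; under eq_fun do rewrite monomial0 mulr1.
have iS (A : set T) : measurable A -> mu.-integrable A (EFin \o G).
  by move=> mA; exact: integrableS Gi.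
have GT : (\int[mu]_x (G x)%:E = 0)%E.
  rewrite (Int_EFin Gi); have := G_eq0 mpoly.mnm0.
  by under eq_Rintegral do rewrite monomial0 mulr1; move=> ->.
have all0 (A : set T) : measurable A -> (\int[mu]_(x in A) (G x)%:E = 0)%E.
  rewrite {1}sigma_algebra_above.
  apply: (@dynkin_induction _ _ _ (fun A => (\int[mu]_(x in A) (G x)%:E = 0)%E)
    sigma_algebra_above) => //.
  - move=> _ _ [s ->] [s' ->]; exists (s ++ s'); apply/seteqP.
    by split => x /=; rewrite /above all_cat; [move=> [-> ->]|move=> /andP].
  - move=> _ [s ->]; rewrite integral_mkcond.
    have ai : integ mu (fun x => G x * (above s x)%:R).
      by apply: integM_bounded => // x; case: above; rewrite ?normr1 ?normr0.
    have a0 : \int[mu]_x (G x * (above s x)%:R) = 0.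
      rewrite -[RHS](Int0_above s mpoly.mnm0).
      by apply: eq_Rintegral => x _; rewrite monomial0 mulr1.
    have := Int_EFin ai; rewrite a0.
    move=> e; apply: (etrans _ e); apply: eq_integral => x _; rewrite /restrict/=.
    rewrite (_ : (x \in _) = above s x); last by apply/idP/idP; rewrite inE.
    by case: above; rewrite ?mulr1 ?mulr0.
  - move=> B mB B0; have := GT; rewrite -(setUv B) integral_setU_EFin//.
    + by rewrite B0 add0e.
    + exact: measurableC.
    + by rewrite setUv; exact: integ_measurable Gi.
    + by apply/disj_setPCl.
  - move=> F mF tF F0; rewrite integral_bigcup//; last exact/iS/bigcup_measurable.
    by apply: eseries0 => k _ _; exact: F0.
have H := @integral_ae_eq _ _ _ mu setT measurableT (cst 0%E) (EFin \o G) Gi (measurable_cst _).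
apply: filterS (H _) => [x /(_ Logic.I) []//|E _ mE].
by rewrite [LHS]all0// integral0.
Qed.

End determinacy.

(** * Square-integrable functions *)

Lemma discriminant_le0 (R : realFieldType) (a b c : R) : 0 <= c ->
  (forall t, 0 <= a + 2 * t * b + t ^+ 2 * c) -> b ^+ 2 <= a * c.
Proof.
move=> c0 H; move: c0; rewrite le_eqVlt => /predU1P[c0|c0].
  have [->|b0] := eqVneq b 0; first by rewrite -c0 mulr0 expr0n.
  have := H (- (a + 1) / (2 * b)); rewrite -c0 mulr0 addr0.
  have -> : a + 2 * (- (a + 1) / (2 * b)) * b = -1.
    by field.
  by rewrite oppr_ge0 leNgt ltr01.
have := H (- b / c).
have -> : a + 2 * (- b / c) * b + (- b / c) ^+ 2 * c = (a * c - b ^+ 2) / c.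
  by field; rewrite gt_eqF.
by rewrite ler_pdivlMr// mul0r subr_ge0.
Qed.

Lemma norm_le_geom (R : realType) (b c : R) k : b ^+ 2 <= 4^-1 ^+ k * c ->
  `|b| <= 2^-1 ^+ k * Num.sqrt c.
Proof.
move=> H; rewrite -sqrtr_sqr; apply: le_trans (ler_wsqrtr H) _.
have -> : (4^-1 : R) ^+ k = (2^-1 ^+ k) ^+ 2.
  by rewrite exprAC expr2 -invfM -natrM.
have k0 : 0 <= (2^-1 : R) ^+ k by rewrite exprn_ge0// invr_ge0.
by rewrite sqrtrM ?sqr_ge0// sqrtr_sqr ger0_norm.
Qed.

Lemma geom_bounded_le0 (R : realType) (x c : R) :
  (forall k, x <= 2^-1 ^+ k * c) -> x <= 0.
Proof.
move=> H; rewrite leNgt; apply/negP => x0.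
have c0 : 0 < c by have := lt_le_trans x0 (H 0%N); rewrite expr0 mul1r.
pose N := Num.bound (c / x).
have := archi_boundP (divr_ge0 (ltW c0) (ltW x0)); rewrite -/N ltr_pdivrMr// => hN.
have := H N; rewrite exprVn mulrC ler_pdivlMr ?exprn_gt0// => /le_lt_trans/(_ hN).
rewrite mulrC ltr_pM2r// -natrX ltr_nat => /ltnW.
by rewrite leqNgt ltn_expl.
Qed.

Section square_integrable.
Context d (T : measurableType d) (R : realType) (mu : {measure set T -> \bar R}).
Implicit Types f g w : T -> R.

Definition sqint f := measurable_fun setT f /\ integ mu (fun x => f x ^+ 2).

Lemma sqintM f g : sqint f -> sqint g -> integ mu (fun x => f x * g x).
Proof.
move=> [mf f2] [mg g2]; apply: (integ_le _ _ (integD f2 g2)).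
  exact: measurable_funM.
move=> x; rewrite normrM -(real_normK (num_real (f x))) -(real_normK (num_real (g x))).
have := sqr_ge0 (`|f x| - `|g x|); rewrite sqrrB.
have : 0 <= `|f x| * `|g x| by rewrite mulr_ge0.
rewrite -mulr_natr; lra.
Qed.

Lemma sqintZ a f : sqint f -> sqint (fun x => a * f x).
Proof.
move=> [mf f2]; split; first exact: measurable_funM.
by under eq_fun do rewrite exprMn; exact: integZ.
Qed.

Lemma sqintD f g : sqint f -> sqint g -> sqint (fun x => f x + g x).
Proof.
move=> sf sg; split; first by apply: measurable_funD; [case: sf|case: sg].
have -> : (fun x => (f x + g x) ^+ 2) =
    (fun x => f x ^+ 2 + (2 * (f x * g x) + g x ^+ 2)).
  by apply/funext => x; ring.
apply: integD; [by case: sf|apply: integD; [|by case: sg]].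
by apply: integZ; exact: sqintM.
Qed.

Lemma sqintB f g : sqint f -> sqint g -> sqint (fun x => f x - g x).
Proof.
move=> sf sg; have := sqintD sf (sqintZ (-1) sg).
by congr sqint; apply/funext => x; rewrite mulN1r.
Qed.

Lemma sqint_norm f : sqint f -> sqint (fun x => `|f x|).
Proof.
move=> [mf f2]; split; first exact: measurableT_comp.
by under eq_fun do rewrite real_normK ?num_real//.
Qed.

Lemma sqintM_bounded f w : sqint f -> measurable_fun setT w ->
  (forall x, `|w x| <= 1) -> sqint (fun x => f x * w x).
Proof.
move=> [mf f2] mw w1; split; first exact: measurable_funM.
under eq_fun do rewrite exprMn; apply: integM_bounded => //.
  exact: measurable_funX.
by move=> x; rewrite normrX exprn_ile1.
Qed.

Lemma Int_sqrD f g a : sqint f -> sqint g ->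
  \int[mu]_x (f x + a * g x) ^+ 2 = \int[mu]_x (f x ^+ 2) +
    2 * a * \int[mu]_x (f x * g x) + a ^+ 2 * \int[mu]_x (g x ^+ 2).
Proof.
move=> sf sg; have ifg := sqintM sf sg; have [_ if2] := sf; have [_ ig2] := sg.
rewrite -IntZ// -IntZ// -IntD//; last exact: integZ.
rewrite -IntD//; [|by apply: integD => //; exact: integZ|exact: integZ].
by apply: eq_Rintegral => x _; ring.
Qed.

Lemma cauchy_schwarz f g : sqint f -> sqint g ->
  (\int[mu]_x (f x * g x)) ^+ 2 <= \int[mu]_x (f x ^+ 2) * \int[mu]_x (g x ^+ 2).
Proof.
move=> sf sg; apply: discriminant_le0; first by apply: Int_ge0 => x; exact: sqr_ge0.
by move=> t; rewrite -Int_sqrD//; apply: Int_ge0 => x; exact: sqr_ge0.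
Qed.

End square_integrable.

Lemma limn_einf_le_near (R : realType) (u : nat -> \bar R) c k :
  (forall n, (k <= n)%N -> (u n <= c)%E) -> (limn_einf u <= c)%E.
Proof.
move=> H; rewrite limn_einf_lim; apply: lime_le; first exact: is_cvg_einfs.
apply: nearW => n; apply: (@le_trans _ _ (u (maxn n k))); last first.
  by apply: H; rewrite leq_maxr.
by apply: ereal_inf_lbound; exists (maxn n k) => //=; rewrite leq_maxl.
Qed.

Lemma limn_einf_ge0 (R : realType) (u : nat -> \bar R) :
  (forall n, (0 <= u n)%E) -> (0 <= limn_einf u)%E.
Proof.
move=> H; rewrite limn_einf_lim; apply: lime_ge; first exact: is_cvg_einfs.
by apply: nearW => n; apply: le_ereal_inf_tmp => _ [m _ <-].
Qed.

Section completeness.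
Context d (T : measurableType d) (R : realType) (mu : {finite_measure set T -> \bar R}).
Variable f : nat -> T -> R.
Hypotheses (sf : forall k, sqint mu (f k))
  (f_cauchy : forall k m, (k <= m)%N ->
    \int[mu]_x (f k x - f m x) ^+ 2 <= 4^-1 ^+ k).

Lemma integ_cst (c : R) : integ mu (fun=> c).
Proof. exact: finite_measure_integrable_cst. Qed.

Let mf k : measurable_fun setT (f k). Proof. by case: (sf k). Qed.

Let increment k x : R := `|f k.+1 x - f k x|.

Let m_increment k : measurable_fun setT (increment k).
Proof. by apply: measurableT_comp => //; exact: measurable_funB. Qed.

(* From 2 y <= 2^k y^2 + 2^-k: a bound of the L^2 norm of the increment by 2^-k
   makes its L^1 norm of order 2^-k as well. *)
Let increment_le k x : increment k x <=
  2 ^+ k * (f k x - f k.+1 x) ^+ 2 + 2^-1 ^+ k * 1.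
Proof.
rewrite /increment distrC -[X in _ * X + _]real_normK ?num_real//.
move: `|_| => y; rewrite exprVn; set t := 2 ^+ k.
have t0 : 0 < t by rewrite exprn_gt0.
have : 0 <= t * (y - t^-1) ^+ 2 by rewrite mulr_ge0 ?sqr_ge0// ltW.
have -> : t * (y - t^-1) ^+ 2 = t * y ^+ 2 - 2 * y + t^-1 by field; rewrite gt_eqF.
have : 0 < t^-1 by rewrite invr_gt0.
have : 0 <= t * y ^+ 2 by rewrite mulr_ge0 ?sqr_ge0// ltW.
lra.
Qed.

Let increment_integ k : integ mu (increment k).
Proof.
apply: (integ_le (g := fun x => 2 ^+ k * (f k x - f k.+1 x) ^+ 2 + 2^-1 ^+ k * 1)) => //.
  by move=> x; rewrite normr_id; exact: increment_le.
apply: integD; apply: integZ; last exact: integ_cst.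
by have [] := sqintB (sf k) (sf k.+1).
Qed.

Let Int_increment_le k : \int[mu]_x increment k x <=
  (1 + \int[mu]_x 1) * 2^-1 ^+ k.
Proof.
have [_ i2] := sqintB (sf k) (sf k.+1).
apply: le_trans (Int_le _ _ (increment_le k)) _ => //.
  by apply: integD; apply: integZ => //; exact: integ_cst.
rewrite IntD; [|exact: integZ|by apply: integZ; exact: integ_cst].
rewrite IntZ// IntZ; last exact: integ_cst.
rewrite mulrDl mul1r [X in _ <= _ + X]mulrC lerD2r.
have := f_cauchy (leqnSn k).
have e : (4^-1 : R) ^+ k = (2^-1 ^+ k) ^+ 2.
  by rewrite exprAC expr2 -invfM -natrM.
have t0 : 0 < (2 : R) ^+ k by rewrite exprn_gt0.
rewrite e -(ler_pM2l t0) => /le_trans; apply.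
by rewrite expr2 mulrA exprVn divff ?gt_eqF// mul1r.
Qed.

Let increments_summable :
  {ae mu, forall x, exists B, forall n, \sum_(k < n) increment k x <= B}.
Proof.
have mE k : measurable_fun setT (EFin \o increment k) by exact/measurable_EFinP.
have E0 k x : [set: T] x -> (0 <= (increment k x)%:E)%E.
  by move=> _; rewrite lee_fin normr_ge0.
have fin : (\int[mu]_x (\sum_(0 <= k <oo) (increment k x)%:E) < +oo)%E.
  rewrite (integral_nneseries mu measurableT mE E0).
  have I0 k : (0 <= \int[mu]_x (increment k x)%:E)%E.
    by apply: integral_ge0 => x _; exact: E0.
  apply: (@le_lt_trans _ _ ((2 * (1 + \int[mu]_x 1))%:E)); last exact: ltry.
  apply: lime_le; first by apply: is_cvg_nneseries => k _ _; exact: I0.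
  apply: nearW => n; rewrite big_mkord.
  under eq_bigr do rewrite (Int_EFin (increment_integ _)).
  rewrite sumEFin lee_fin.
  apply: (@le_trans _ _ (\sum_(k < n) (1 + \int[mu]_x 1) * 2^-1 ^+ k)).
    by apply: ler_sum => k _; exact: Int_increment_le.
  rewrite -mulr_sumr mulrC ler_wpM2r ?sum_half_le// addr_ge0//.
  exact: Int_ge0.
have mS : measurable_fun setT (fun x => \sum_(0 <= k <oo) (increment k x)%:E)%E.
  exact: (@ge0_emeasurable_sum _ _ _ _ (fun k x => (increment k x)%:E) xpredT
    (fun k x Dx _ => E0 k x Dx) (fun k _ => mE k)).
have iS : mu.-integrable setT (fun x => \sum_(0 <= k <oo) (increment k x)%:E)%E.
  apply/integrableP; split => //.
  rewrite (eq_integral (fun x => \sum_(0 <= k <oo) (increment k x)%:E)%E)// => x _.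
  by rewrite gee0_abs// nneseries_ge0// => k _ _; exact: E0.
apply: filterS (integrable_ae measurableT iS) => x /(_ Logic.I) xfin.
exists (fine (\sum_(0 <= k <oo) (increment k x)%:E)%E) => n.
rewrite -lee_fin fineK// -sumEFin -(big_mkord xpredT (fun k => (increment k x)%:E)).
by apply: nneseries_lim_ge => k _ _; exact: E0.
Qed.

(* The upper limit is measurable without any convergence assumption. *)
Let lim_f x := fine (limn_esup (fun k => (f k x)%:E)).

Let f_cvg_ae : {ae mu, forall x, f ^~ x @ \oo --> lim_f x}.
Proof.
apply: filterS increments_summable => x [B hB].
have cv : cvgn (series (telescope (f ^~ x))).
  apply: normed_cvg; apply: nondecreasing_is_cvgn.
    apply/nondecreasing_seqP => n.
    change (\sum_(0 <= k < n) increment k x <= \sum_(0 <= k < n.+1) increment k x).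
    by rewrite big_nat_recr//= lerDl normr_ge0.
  exists B => _ [n _ <-]; change (\sum_(0 <= k < n) increment k x <= B).
  by rewrite big_mkord; exact: hB.
have {}cv : cvgn (f ^~ x).
  rewrite (_ : f ^~ x = fun n => f 0%N x + series (telescope (f ^~ x)) n).
    by apply: is_cvgD => //; exact: is_cvg_cst.
  by apply/funext => n; exact: eq_sum_telescope.
have H : (f n x)%:E @[n --> \oo] --> (limn (f ^~ x))%:E.
  by apply: cvg_EFin => //; exact: nearW.
rewrite /lim_f is_cvg_limn_esupE; last by apply/cvg_ex; eexists; exact: H.
by rewrite (cvg_lim _ H)//=.
Qed.

(** Riesz-Fischer for fast Cauchy sequences: the increments are summable almost
    everywhere, and Fatou's lemma turns the Cauchy bound into a bound of the
    distance to the limit. *)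
Lemma square_integrable_complete : exists h, sqint mu h /\
  forall k, \int[mu]_x (f k x - h x) ^+ 2 <= 4^-1 ^+ k.
Proof.
have mh : measurable_fun setT lim_f.
  apply: measurableT_comp => //.
  by apply: measurable_fun_limn_esup => k; exact/measurable_EFinP.
have msq k (g : T -> R) : measurable_fun setT g ->
    measurable_fun setT (fun x => ((f k x - g x) ^+ 2)%:E).
  by move=> mg; apply/measurable_EFinP; apply: measurable_funX; exact: measurable_funB.
have sq0 k m x : [set: T] x -> (0 <= ((f k x - f m x) ^+ 2)%:E)%E.
  by rewrite lee_fin sqr_ge0.
have bound k : (\int[mu]_x ((f k x - lim_f x) ^+ 2)%:E <= (4^-1 ^+ k)%:E)%E.
  have F := fatou mu measurableT (fun m => msq k _ (mf m)) (sq0 k).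
  apply: le_trans (le_trans F _).
  - rewrite le_eqVlt; apply/orP; left; apply/eqP.
    apply: ge0_ae_eq_integral => //.
    + exact: msq.
    + rewrite (_ : (fun x => _) = fun x =>
          (- limn_esup (fun m => - ((f k x - f m x) ^+ 2)%:E))%E).
        apply: measurableT_comp => //; apply: measurable_fun_limn_esup => m.
        by apply: measurableT_comp => //; exact: msq.
      by apply/funext => x; rewrite limn_esupN oppeK.
    + by move=> x _; rewrite lee_fin sqr_ge0.
    + by move=> x _; apply: limn_einf_ge0 => m; rewrite lee_fin sqr_ge0.
    apply: filterS f_cvg_ae => x cx _.
    have H : (((f k x - f m x) ^+ 2)%:E) @[m --> \oo] --> (((f k x - lim_f x) ^+ 2)%:E).
      apply: cvg_EFin; first exact: nearW.
      by apply: cvgM; (apply: cvgB; [exact: cvg_cst|exact: cx]).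
    rewrite is_cvg_limn_einfE; last by apply/cvg_ex; eexists; exact: H.
    by rewrite (cvg_lim _ H).
  - apply: (@limn_einf_le_near _ _ _ k) => m km.
    have [_ i2] := sqintB (sf k) (sf m).
    by rewrite (Int_EFin i2) lee_fin; exact: f_cauchy.
have h2 k : integ mu (fun x => (f k x - lim_f x) ^+ 2).
  apply/integrableP; split; first exact: msq.
  under eq_integral do rewrite gee0_abs ?lee_fin ?sqr_ge0//.
  by apply: le_lt_trans (bound k) _; exact: ltry.
have sfh k : sqint mu (fun x => f k x - lim_f x).
  by split => //; exact: measurable_funB.
exists lim_f; split.
  have := sqintB (sf 0%N) (sfh 0%N); congr sqint.
  by apply/funext => x; rewrite subKr.
by move=> k; rewrite -lee_fin -(Int_EFin (h2 k)).
Qed.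

End completeness.

(** * The Riesz representation theorem *)

Section riesz.
Context d (T : measurableType d) (R : realType) (mu : {finite_measure set T -> \bar R}).
Variables (V : lmodType R) (phi : V -> T -> R) (L : V -> R) (C : R).
Hypotheses (phi_lin : forall a v w x, phi (a *: v + w) x = a * phi v x + phi w x)
  (L_lin : forall a v w, L (a *: v + w) = a * L v + L w)
  (phi_sq : forall v, sqint mu (phi v))
  (C_ge0 : 0 <= C)
  (L_le : forall v, L v ^+ 2 <= C * \int[mu]_x (phi v x ^+ 2)).

Let E v := \int[mu]_x (phi v x ^+ 2).
Let B v w := \int[mu]_x (phi v x * phi w x).
Let J v := E v - 2 * L v.

Let E_ge0 v : 0 <= E v. Proof. by apply: Int_ge0 => x; exact: sqr_ge0. Qed.

Let E_lin a v w : E (a *: v + w) = E w + 2 * a * B w v + a ^+ 2 * E v.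
Proof.
rewrite -Int_sqrD//; apply: eq_Rintegral => x _.
by rewrite phi_lin addrC.
Qed.

Let J_lin a v w : J (a *: v + w) = J w + 2 * a * (B w v - L v) + a ^+ 2 * E v.
Proof. by rewrite /J E_lin L_lin; ring. Qed.

(* |2 L v| <= 2 sqrt (C E v) <= E v + C *)
Let J_ge v : - C <= J v.
Proof.
rewrite /J; have := L_le v; rewrite -/(E v); have := E_ge0 v.
move: (E v) (L v) => e l e0 h; rewrite leNgt; apply/negP => H.
have h1 : 0 <= (e - C) ^+ 2 by exact: sqr_ge0.
have h2 : e + C < 2 * l by lra.
have h3 : 0 <= e + C by rewrite addr_ge0.
have : (e + C) ^+ 2 < (2 * l) ^+ 2 by rewrite ltrXn2r.
have -> : (2 * l) ^+ 2 = 4 * l ^+ 2 by ring.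
have -> : (e + C) ^+ 2 = (e - C) ^+ 2 + 4 * (C * e) by ring.
lra.
Qed.

Let dist2 v w := \int[mu]_x (phi v x - phi w x) ^+ 2.

(* the parallelogram identity, in terms of J because the linear parts cancel *)
Let dist2E v w : dist2 v w = 2 * J v + 2 * J w - 4 * J (2^-1 *: (v + w)).
Proof.
have -> : dist2 v w = E v - 2 * B v w + E w.
  have := Int_sqrD (-1) (phi_sq v) (phi_sq w).
  rewrite mulrN1 mulNr expr2 mulrNN !mul1r => <-.
  by apply: eq_Rintegral => x _; rewrite mulN1r.
have e0 : 2^-1 *: (v + w) = 2^-1 *: (1 *: v + w) + 0 by rewrite scale1r addr0.
have L0 : L 0 = 0.
  by have := L_lin 1 0 0; rewrite scale1r addr0 mul1r; lra.
have phi0 x : phi 0 x = 0.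
  by have := phi_lin 1 0 0 x; rewrite scale1r addr0 mul1r; lra.
have E00 : E 0 = 0.
  by rewrite /E; under eq_Rintegral do rewrite phi0 expr0n/=; rewrite Int0.
have B0 u : B 0 u = 0.
  by rewrite /B; under eq_Rintegral do rewrite phi0 mul0r; rewrite Int0.
have Bs : B w v = B v w by apply: eq_Rintegral => x _; rewrite mulrC.
by rewrite e0 J_lin B0 E_lin Bs /J E00 L0 L_lin; field.
Qed.

(** The space of the functions [phi v] is not assumed closed, so the function that
    represents L is found as the limit of a minimising sequence of
    J v = E v - 2 L v, which is Cauchy by the parallelogram identity; the almost
    minimality of [v_ k] gives (B (v_ k) v - L v)^2 <= 4^-k E v by a discriminant.
    The sequence is part of the conclusion: it approximates h within the space. *)
Lemma riesz_representation : exists (h : T -> R) (v_ : nat -> V),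
  [/\ sqint mu h, forall k, \int[mu]_x (phi (v_ k) x - h x) ^+ 2 <= 4^-1 ^+ k &
      forall v, L v = \int[mu]_x (h x * phi v x)].
Proof.
pose S := [set J v | v in setT]; pose m := inf S.
have S_inf : has_inf S.
  split; first by exists (J 0), 0.
  by exists (- C) => _ [v _ <-]; exact: J_ge.
have mJ v : m <= J v by apply: ge_inf; [case: S_inf|exists v].
have q0 k : 0 < (4^-1 : R) ^+ k by rewrite exprn_gt0// invr_gt0.
have /choice[v_ hv] k : exists v, J v <= m + 4^-1 ^+ k / 4.
  have [|_ [v _ <-] /ltW] := @inf_adherent _ S (4^-1 ^+ k / 4) _ S_inf.
    by rewrite divr_gt0.
  by move=> hv; exists v.
have cauchy k l : (k <= l)%N -> dist2 (v_ k) (v_ l) <= 4^-1 ^+ k.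
  move=> kl; rewrite dist2E; have := mJ (2^-1 *: (v_ k + v_ l)).
  have := hv k; have := hv l.
  have : (4^-1 : R) ^+ l <= 4^-1 ^+ k.
    by rewrite ler_wiXn2l ?invr_ge0// invf_le1// ler1n.
  lra.
have [h [sh hk]] := square_integrable_complete (fun k => phi_sq (v_ k)) cauchy.
exists h, v_; split => // v; apply/eqP; rewrite -subr_eq0 -normr_le0.
apply: (@geom_bounded_le0 _ _ (2 * Num.sqrt (E v))) => k.
have h1 : `|B (v_ k) v - L v| <= 2^-1 ^+ k * Num.sqrt (E v).
  apply: norm_le_geom; apply: discriminant_le0 => // t.
  have := mJ (t *: v + v_ k); rewrite J_lin; have := hv k; have := q0 k.
  lra.
have h2 : `|B (v_ k) v - \int[mu]_x (h x * phi v x)| <= 2^-1 ^+ k * Num.sqrt (E v).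
  apply: norm_le_geom.
  have sd := sqintB (phi_sq (v_ k)) sh.
  rewrite (_ : B (v_ k) v - _ = \int[mu]_x ((phi (v_ k) x - h x) * phi v x)).
    by apply: le_trans (cauchy_schwarz sd (phi_sq v)) _; rewrite ler_wpM2r// E_ge0.
  rewrite /B -IntB; [|exact: sqintM|exact: sqintM].
  by apply: eq_Rintegral => x _; rewrite mulrBl.
rewrite -[L v](subrK (B (v_ k) v)) -addrA.
apply: le_trans (ler_normD _ _) _; rewrite distrC.
by move: h1 h2; set q := 2^-1 ^+ k; set sq := Num.sqrt _; nra.
Qed.

End riesz.

(** * The Carleman condition for eighth roots of moments *)

Section power_weights.
Variable R : realType.

Lemma divergent_step4 (p : nat -> R) : (forall k, 0 < p k) ->
  (forall i j, (i <= j)%N -> p j <= p i) -> divergent p ->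
  divergent (fun k => p (4 * k)%N).
Proof.
move=> p0 ple pdiv A; have [n hn] := pdiv (\sum_(1 <= k < 4) p k + 4 * A).
exists n.+1.
have block N : \sum_(4 <= k < 4 * N.+1) p k <= 4 * \sum_(1 <= k < N.+1) p (4 * k)%N.
  elim: N => [|N IH]; first by rewrite !big_geq// mulr0.
  rewrite (@big_cat_nat _ _ _ (4 * N.+1))//=; [|by rewrite mulnS|by rewrite leq_mul2l/=].
  rewrite [X in _ <= 4 * X]big_nat_recr//= mulrDr lerD//.
  have -> : (4 * N.+2 = (4 * N.+1).+4)%N by rewrite [LHS]mulnS.
  set m := (4 * N.+1)%N.
  have -> : \sum_(m <= i < m.+4) p i = p m + p m.+1 + p m.+2 + p m.+3.
    rewrite -{1}[m]add0n -[m.+4]/(4 + m)%N big_addn addnK.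
    by rewrite !big_nat_recr//= big_geq// add0r.
  have h i : p (m + i)%N <= p m by apply: ple; rewrite leq_addr.
  have := h 1%N; have := h 2%N; have := h 3%N; rewrite addn1 addn2 addn3.
  lra.
have mono : \sum_(1 <= k < n) p k <= \sum_(1 <= k < 4 * n.+1) p k.
  have [n0|n1] := leqP n 1.
    by rewrite big_geq// sumr_ge0// => i _; exact: ltW.
  rewrite [leRHS](@big_cat_nat _ _ _ n)//=; [|exact: ltnW|].
    by rewrite lerDl sumr_ge0// => i _; exact: ltW.
  by rewrite (leq_trans (leqnSn n))// leq_pmull.
have := block n; move: mono.
rewrite (@big_cat_nat _ _ _ 4 1 (4 * n.+1))//=; last by rewrite mulnS leq_addr.
lra.
Qed.

Definition root8 (x : R) := Num.sqrt (Num.sqrt (Num.sqrt x)).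

Lemma root8M (r x : R) : 0 <= r -> root8 (r ^+ 8 * x) = r * root8 x.
Proof.
move=> r0; rewrite /root8 (_ : r ^+ 8 = (r ^+ 4) ^+ 2); last by rewrite -exprM.
rewrite sqrtrM ?sqr_ge0// sqrtr_sqr ger0_norm ?exprn_ge0//.
rewrite (_ : r ^+ 4 = (r ^+ 2) ^+ 2); last by rewrite -exprM.
rewrite sqrtrM ?sqr_ge0// sqrtr_sqr ger0_norm ?exprn_ge0//.
by rewrite sqrtrM ?sqr_ge0// sqrtr_sqr ger0_norm.
Qed.

(** If p_k^2 a_k <= a_(k-1) then p_(4k)^8 a_(4k) <= a_(4k-4), the p_k being
    nonincreasing; and dividing the indices by 4 preserves the divergence. *)
Lemma quasianalytic_root8 (a : nat -> R) (c : R) : 0 <= c ->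
  (forall k, 0 <= a k) -> (forall k, a k.+1 ^+ 2 <= a k * a k.+2) ->
  (\sum_(1 <= k <oo)
    (if a k == 0%R then +oo else (a k `^ (- (2 * k)%:R^-1))%:E))%E = +oo%E ->
  quasianalytic (fun k => c * root8 (a (4 * k)%N)).
Proof.
move=> c0 a0 alog asum.
have [p [p0 ple pa pdiv]] := carleman_quotients a0 alog asum.
exists (fun k => p (4 * k)%N); split => //.
- by move=> i j ij; apply: ple; rewrite leq_mul2l.
- move=> k; rewrite mulrCA ler_wpM2l//.
  set P := p (4 * k.+1)%N.
  have P0 : 0 <= P by exact/ltW/p0.
  rewrite -root8M// !ler_wsqrtr//.
  have h j : (j < 4)%N -> P ^+ 2 * a (4 * k + j).+1 <= a (4 * k + j)%N.
    move=> j4; apply: le_trans (pa _); rewrite ler_wpM2r// lerXn2r// ?nnegrE//;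
    first exact/ltW/p0.
    by apply: ple; rewrite mulnS -addnS [leqRHS]addnC leq_add2l.
  have P2 : 0 <= P ^+ 2 by exact: sqr_ge0.
  have := h 0%N isT; have := h 1%N isT; have := h 2%N isT; have := h 3%N isT.
  have -> : (4 * k.+1 = (4 * k + 3).+1)%N by rewrite mulnS addnC -addnS.
  rewrite addn0 addn1 addn2 addn3 => h3 h2 h1 h0.
  set y := a _; rewrite (_ : P ^+ 8 * y = P ^+ 2 * (P ^+ 2 * (P ^+ 2 * (P ^+ 2 * y)))).
    by apply: le_trans h0; rewrite ler_wpM2l//; apply: le_trans h1;
      rewrite ler_wpM2l//; apply: le_trans h2; rewrite ler_wpM2l.
  by ring.
- exact: divergent_step4.
Qed.

Lemma le_sqrtM (x a y : R) : 0 <= a -> x ^+ 2 <= a * y ->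
  x <= Num.sqrt a * Num.sqrt y.
Proof.
move=> a0 H; rewrite -sqrtrM//; apply: le_trans (ler_norm _) _.
by rewrite -sqrtr_sqr ler_wsqrtr.
Qed.

End power_weights.

(** * Polynomials and their integrals *)

Section polynomials.
Context (R : realType) (n : nat).
Local Notation T := (n.-tuple R).
Local Notation poly := (mpoly.mpoly n R).
Implicit Types (p q : poly) (y : mpoly.multinom n -> R).

Definition evalp p (x : T) : R := mpoly.meval (tnth x) p.

Lemma evalpE p x :
  evalp p x = \sum_(m <- mpoly.msupp p) mpoly.mcoeff m p * monomial m x.
Proof. exact: mpoly.mevalE. Qed.

Lemma evalp_lin a p q x : evalp (a *: p + q) x = a * evalp p x + evalp q x.
Proof. by rewrite /evalp mpoly.mevalD mpoly.mevalZ. Qed.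

Lemma evalpM p q x : evalp (p * q) x = evalp p x * evalp q x.
Proof. by rewrite /evalp mpoly.mevalM. Qed.

Lemma evalpX p k x : evalp (p ^+ k) x = evalp p x ^+ k.
Proof. by rewrite /evalp rmorphXn. Qed.

Lemma evalp1 x : evalp 1 x = 1.
Proof. exact: mpoly.meval1. Qed.

Lemma evalp_mpolyX a x : evalp (mpoly.mpolyX R a) x = monomial a x.
Proof. exact: mpoly.mevalX. Qed.

Lemma riesz_functional_supp y p (s : seq (mpoly.multinom n)) : uniq s ->
  {subset mpoly.msupp p <= s} ->
  riesz_functional y p = \sum_(m <- s) mpoly.mcoeff m p * y m.
Proof.
move=> us ps; rewrite [RHS](bigID (fun m => m \in mpoly.msupp p))/=.
rewrite [X in _ = _ + X]big1 ?addr0; last first.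
  by move=> m; rewrite -mpoly.mcoeff_eq0 => /eqP ->; rewrite mul0r.
rewrite -big_filter; apply: perm_big; apply: uniq_perm => [||m].
- exact: mpoly.msupp_uniq.
- exact: filter_uniq.
- by rewrite mem_filter; apply/idP/andP => [mp|[]//]; split => //; exact: ps.
Qed.

Lemma riesz_functional_lin y a p q :
  riesz_functional y (a *: p + q) = a * riesz_functional y p + riesz_functional y q.
Proof.
pose s := undup (mpoly.msupp p ++ mpoly.msupp q ++ mpoly.msupp (a *: p + q)).
have us : uniq s by exact: undup_uniq.
rewrite !(@riesz_functional_supp y _ s)//; try by
  move=> m ms; rewrite mem_undup !mem_cat ms ?orbT.
rewrite mulr_sumr -big_split/=; apply: eq_bigr => m _.
by rewrite mpoly.mcoeffD mpoly.mcoeffZ mulrDl mulrA.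
Qed.

Lemma riesz_functional_mpolyX y a : riesz_functional y (mpoly.mpolyX R a) = y a.
Proof.
by rewrite /riesz_functional mpoly.msuppX big_seq1 mpoly.mcoeffX eqxx mul1r.
Qed.

End polynomials.

Section carleman_measure.
Context (R : realType) (n : nat).
Local Notation T := (n.-tuple R).
Variables (mu : {finite_measure set T -> \bar R}) (z : mpoly.multinom n -> R).
Hypotheses (hz : has_moments mu z).

Lemma integ_monomial a : integ mu (@monomial R n a).
Proof. exact: (hz a).1. Qed.

Lemma integ_evalp p : integ mu (evalp p).
Proof.
have -> : evalp p = fun x => \sum_(m <- mpoly.msupp p) mpoly.mcoeff m p * monomial m x.
  by apply/funext => x; exact: evalpE.
elim: (mpoly.msupp p) => [|m s IH].
  by under eq_fun do rewrite big_nil; exact: integ0.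
under eq_fun do rewrite big_cons.
by apply: integD => //; apply: integZ; exact: integ_monomial.
Qed.

Lemma riesz_functional_Int p : riesz_functional z p = \int[mu]_x evalp p x.
Proof.
have -> : evalp p = fun x => \sum_(m <- mpoly.msupp p) mpoly.mcoeff m p * monomial m x.
  by apply/funext => x; exact: evalpE.
rewrite /riesz_functional; elim: (mpoly.msupp p) => [|m s IH].
  by rewrite big_nil; under eq_Rintegral do rewrite big_nil; rewrite Int0.
rewrite big_cons IH; under [in RHS]eq_Rintegral do rewrite big_cons.
have is_ (s' : seq (mpoly.multinom n)) :
    integ mu (fun x => \sum_(m <- s') mpoly.mcoeff m p * monomial m x).
  elim: s' => [|m' s' IH'].
    by under eq_fun do rewrite big_nil; exact: integ0.
  under eq_fun do rewrite big_cons.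
  by apply: integD => //; apply: integZ; exact: integ_monomial.
rewrite IntD//; last by apply: integZ; exact: integ_monomial.
rewrite IntZ; last exact: integ_monomial.
by rewrite /Rintegral -(hz m).2.
Qed.

Lemma sqint_evalp p : sqint mu (evalp p).
Proof.
split; first exact: integ_measurable (integ_evalp p).
have := integ_evalp (p ^+ 2); congr (integ mu _).
by apply/funext => x; exact: evalpX.
Qed.

Let power (i : 'I_n) k : mpoly.mpoly n R := mpoly.mpolyX R (mpoly.mnm1 i) ^+ k.

Let evalp_power i k x : evalp (power i k) x = tnth x i ^+ k.
Proof. by rewrite evalpX /evalp mpoly.mevalXU. Qed.

Let evenmoment (i : 'I_n) k := \int[mu]_x (tnth x i ^+ (2 * k)).

Let evenmoment_ge0 i k : 0 <= evenmoment i k.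
Proof. by apply: Int_ge0 => x; rewrite mulnC exprM sqr_ge0. Qed.

Let evenmoment_logconvex i k :
  evenmoment i k.+1 ^+ 2 <= evenmoment i k * evenmoment i k.+2.
Proof.
have := cauchy_schwarz (sqint_evalp (power i k)) (sqint_evalp (power i k.+2)).
have e1 : \int[mu]_x (evalp (power i k) x * evalp (power i k.+2) x) = evenmoment i k.+1.
  apply: eq_Rintegral => x _; rewrite !evalp_power -exprD; congr (_ ^+ _).
  by rewrite mul2n -addnn addSn addnS.
have e2 j : \int[mu]_x (evalp (power i j) x ^+ 2) = evenmoment i j.
  by apply: eq_Rintegral => x _; rewrite !evalp_power -exprM mulnC.
by rewrite e1 !e2.
Qed.

Hypothesis hcarleman : generalized_carleman z.

Let quasianalytic_evenmoment i (c : R) : 0 <= c ->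
  quasianalytic (fun k => c * root8 (evenmoment i (4 * k))).
Proof.
move=> c0; apply: quasianalytic_root8 => //; rewrite -[RHS](hcarleman i).
congr (limn _); apply/funext => N; apply: eq_bigr => k _.
rewrite /carleman_term riesz_functional_Int.
have -> : \int[mu]_x evalp (mpoly.mpolyX R (mpoly.mnm1 i) ^+ (2 * k)) x = evenmoment i k.
  by apply: eq_Rintegral => x _; exact: evalp_power.
by [].
Qed.

(** With X = monomial a * x_i^k, three applications of Cauchy-Schwarz separate
    successively q from s X, then |h| = s^2 from X^2, then the monomial from the
    power of x_i; what remains is the eighth root of the moment of x_i^(8k). *)
Lemma weighted_moments_quasianalytic (h s q : T -> R) a i :
  sqint mu h -> measurable_fun setT s -> (forall x, s x ^+ 2 = `|h x|) -> sqint mu q ->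
  exists2 M, quasianalytic M &
    forall k, \int[mu]_x `|s x * q x * monomial a x * tnth x i ^+ k| <= M k.
Proof.
move=> sh ms s2 sq.
pose A := \int[mu]_x (q x ^+ 2); pose B := \int[mu]_x (`|h x| ^+ 2).
pose C := \int[mu]_x ((monomial a x ^+ 4) ^+ 2).
have A0 : 0 <= A by apply: Int_ge0 => x; exact: sqr_ge0.
have B0 : 0 <= B by apply: Int_ge0 => x; exact: sqr_ge0.
have C0 : 0 <= C by apply: Int_ge0 => x; exact: sqr_ge0.
exists (fun k => Num.sqrt A * Num.sqrt (Num.sqrt B) * Num.sqrt (Num.sqrt (Num.sqrt C)) *
  root8 (evenmoment i (4 * k))).
  by apply: quasianalytic_evenmoment; rewrite !mulr_ge0.
move=> k.
pose P : mpoly.mpoly n R := mpoly.mpolyX R a * power i k.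
have PE x : evalp P x = monomial a x * tnth x i ^+ k.
  by rewrite evalpM evalp_mpolyX evalp_power.
have sP : sqint mu (fun x => s x * evalp P x).
  split; first by apply: measurable_funM => //; case: (sqint_evalp P).
  have := sqintM (sqint_norm sh) (sqint_evalp (P ^+ 2)).
  by congr (integ mu _); apply/funext => x; rewrite evalpX exprMn s2.
have bound1 : \int[mu]_x `|s x * q x * monomial a x * tnth x i ^+ k| <=
    Num.sqrt A * Num.sqrt (\int[mu]_x ((s x * evalp P x) ^+ 2)).
  apply: le_sqrtM => //.
  have -> : \int[mu]_x `|s x * q x * monomial a x * tnth x i ^+ k| =
      \int[mu]_x (`|q x| * `|s x * evalp P x|).
    by apply: eq_Rintegral => x _; rewrite PE -normrM; congr (`|_|); ring.
  apply: le_trans (cauchy_schwarz (sqint_norm sq) (sqint_norm sP)) _.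
  rewrite /A le_eqVlt; apply/orP; left; apply/eqP.
  by congr (_ * _); apply: eq_Rintegral => x _; rewrite real_normK ?num_real.
have bound2 : \int[mu]_x ((s x * evalp P x) ^+ 2) <=
    Num.sqrt B * Num.sqrt (\int[mu]_x (evalp (P ^+ 2) x ^+ 2)).
  apply: le_sqrtM => //.
  have -> : \int[mu]_x ((s x * evalp P x) ^+ 2) = \int[mu]_x (`|h x| * evalp (P ^+ 2) x).
    by apply: eq_Rintegral => x _; rewrite evalpX exprMn s2.
  exact: cauchy_schwarz (sqint_norm sh) (sqint_evalp _).
have bound3 : \int[mu]_x (evalp (P ^+ 2) x ^+ 2) <=
    Num.sqrt C * Num.sqrt (evenmoment i (4 * k)).
  apply: le_sqrtM => //.
  have -> : \int[mu]_x (evalp (P ^+ 2) x ^+ 2) =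
      \int[mu]_x (evalp (mpoly.mpolyX R a ^+ 4) x * evalp (power i (4 * k)) x).
    apply: eq_Rintegral => x _; rewrite evalp_power !evalpX PE evalp_mpolyX.
    by rewrite -exprM exprMn -exprM [(k * _)%N]mulnC.
  apply: le_trans (cauchy_schwarz (sqint_evalp _) (sqint_evalp _)) _.
  rewrite le_eqVlt; apply/orP; left; apply/eqP; congr (_ * _).
    by apply: eq_Rintegral => x _; rewrite evalpX evalp_mpolyX.
  by apply: eq_Rintegral => x _; rewrite evalp_power -exprM mulnC.
apply: le_trans bound1 _; rewrite /root8 -!mulrA ler_wpM2l//.
apply: le_trans (ler_wsqrtr bound2) _; rewrite sqrtrM// ler_wpM2l//.
apply: le_trans (ler_wsqrtr (ler_wsqrtr bound3)) _.
by rewrite sqrtrM// sqrtrM.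
Qed.

End carleman_measure.

(** * Measures with a bounded density *)

Section density.
Context d (T : measurableType d) (R : realType).
Variables (mu : {finite_measure set T -> \bar R}) (f : T -> R) (c : R).
Hypotheses (mf : measurable_fun setT f) (f_ge0 : forall x, 0 <= f x)
  (f_le : forall x, f x <= c).

(** The proofs are arguments because they are what makes this set function a
    finite measure, and its instances are inferred from the term. *)
Definition density_of (_ : measurable_fun setT f) (_ : forall x, 0 <= f x)
  (_ : forall x, f x <= c) : set T -> \bar R := fun A => (\int[mu]_(x in A) (f x)%:E)%E.

Local Notation nu := (density_of mf f_ge0 f_le).

Let mE : measurable_fun setT (EFin \o f). Proof. exact/measurable_EFinP. Qed.

Let f_integ : integ mu f.
Proof.
by apply: (integ_le mf _ (integ_cst mu c)) => x; rewrite ger0_norm.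
Qed.

Let nu0 : nu set0 = 0%E. Proof. exact: integral_set0. Qed.

Let nu_ge0 A : (0 <= nu A)%E.
Proof. by apply: integral_ge0 => x _; rewrite lee_fin. Qed.

Let nu_sigma_additive : semi_sigma_additive nu.
Proof.
apply: (@semi_sigma_additive_nng_induced _ _ _ mu (EFin \o f) mE) => x.
by rewrite lee_fin.
Qed.

HB.instance Definition _ := isMeasure.Build _ _ _ nu nu0 nu_ge0 nu_sigma_additive.

Let nu_fin : fin_num_fun nu.
Proof.
by move=> A mA; apply: integrable_fin_num => //; exact: integrableS f_integ.
Qed.

HB.instance Definition _ := @Measure_isFinite.Build _ _ _ nu nu_fin.

Definition density_measure : {finite_measure set T -> \bar R} := nu.

Local Notation NU := density_measure.

Lemma density_dominates : NU `<< mu.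
Proof.
apply/null_content_dominatesP => A mA muA; apply: null_set_integral => //.
exact: measurable_funTS.
Qed.

Local Notation RN := (Radon_Nikodym (charge_of_finite_measure NU) mu).

Let measurable_RN : measurable_fun setT RN.
Proof.
have dom : charge_of_finite_measure NU `<< mu := density_dominates.
exact: measurable_int (Radon_Nikodym_integrable dom).
Qed.

Lemma density_RN : ae_eq mu setT RN (EFin \o f).
Proof.
have dom : charge_of_finite_measure NU `<< mu := density_dominates.
apply: integral_ae_eq => //; first exact: (Radon_Nikodym_integrable dom).
by move=> A _ mA; rewrite -Radon_Nikodym_integral.
Qed.

Lemma density_integral g : integ mu g -> integ NU g /\
  (\int[NU]_x (g x)%:E = \int[mu]_x (f x * g x)%:E)%E.
Proof.
move=> gi; have mg := integ_measurable gi.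
have dom := density_dominates.
have RNs : ae_eq mu setT (Radon_Nikodym_SigmaFinite.f NU mu) (EFin \o f).
  exact: ae_eq_trans (ae_eq_Radon_Nikodym_SigmaFinite dom measurableT) density_RN.
have mRN : measurable_fun setT (Radon_Nikodym_SigmaFinite.f NU mu).
  exact: measurable_int (Radon_Nikodym_SigmaFinite.f_integrable dom).
have gNU : integ NU g.
  apply/integrableP; split; first exact/measurable_EFinP.
  rewrite -(Radon_Nikodym_SigmaFinite.change_of_variables dom)//; last first.
    by apply/measurableT_comp => //; exact/measurable_EFinP.
  rewrite (ae_eq_integral (fun x => (`|g x| * f x)%:E))//.
  - have : integ mu (fun x => `|g x| * f x).
      apply: (integ_le _ _ (integZ c (integ_norm gi))).
        by apply: measurable_funM => //; exact: measurableT_comp.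
      by move=> x; rewrite normrM normr_id (ger0_norm (f_ge0 x)) mulrC ler_wpM2r.
    by move=> /(Int_EFin) ->; exact: ltry.
  - apply: emeasurable_funM => //.
    by apply/measurableT_comp => //; exact/measurable_EFinP.
  - by apply/measurable_EFinP/measurable_funM => //; exact: measurableT_comp.
  - by apply: filterS RNs => x h /h /= ->.
split => //; rewrite -(Radon_Nikodym_change_of_variables dom)//.
apply: ae_eq_integral => //.
- apply: emeasurable_funM; [exact/measurable_EFinP|exact: measurable_RN].
- by apply/measurable_EFinP/measurable_funM.
- by apply: filterS density_RN => x h /h ->; rewrite -EFinM mulrC.
Qed.

Lemma density_RN_bounded : (fine \o RN) \in Lfun mu +oo%E.
Proof.
have mRN : measurable_fun setT (fine \o RN).
  by apply: measurableT_comp => //; exact: measurable_RN.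
rewrite inE; apply/andP; split; rewrite inE//=.
rewrite /finite_norm unlock; case: ifPn => _; last exact: ltry.
apply: (@le_lt_trans _ _ c%:E); last exact: ltry.
apply/ess_supP; apply: filterS density_RN => x /(_ Logic.I) /= ->.
by rewrite lee_fin /= ger0_norm.
Qed.

End density.

(** * Densities that are nonnegative on squares *)

Section positivity.
Context (R : realType) (n : nat).
Local Notation T := (n.-tuple R).
Variables (mu : {finite_measure set T -> \bar R}) (z : mpoly.multinom n -> R).
Hypotheses (hz : has_moments mu z) (hcarleman : generalized_carleman z).

(** With s = sqrt |h|, the functions s p_k tend in L^2(mu) to H, and H = s 1_(h < 0)
    almost everywhere by the uniqueness of vanishing moments.  Since
    h = s^2 sg h, the integrals of h p_k^2 tend to that of
    H^2 sg h = - |h| 1_(h < 0), which is therefore nonnegative. *)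
Lemma ae_ge0_of_squares (h : T -> R) : sqint mu h ->
  (forall p, 0 <= \int[mu]_x (h x * evalp p x ^+ 2)) ->
  {ae mu, forall x, 0 <= h x}.
Proof.
move=> sh hpos; have [mh h2] := sh.
pose s x := Num.sqrt `|h x|.
have s2 x : s x ^+ 2 = `|h x| by rewrite sqr_sqrtr.
have mnh : measurable_fun setT (fun x => `|h x|) by exact: measurableT_comp.
have ms : measurable_fun setT s.
  apply: (measurableT_comp _ mnh); apply: continuous_measurable_fun.
  exact: sqrt_continuous.
have is2 : integ mu (fun x => s x ^+ 2).
  under eq_fun do rewrite s2.
  have := sqintM (sqint_norm sh) (sqint_evalp hz 1).
  by congr (integ mu _); apply/funext => x; rewrite evalp1 mulr1.
have ss : sqint mu s by [].
pose chi x : R := (h x < 0)%R%:R.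
have mchi : measurable_fun setT chi.
  rewrite (_ : chi = \1_(h @^-1` `]-oo, 0[%classic)).
    by apply: measurable_indic; rewrite -[X in measurable X]setTI; exact: mh.
  apply/funext => x; rewrite indicE /chi; congr (_%:R); congr nat_of_bool.
  by apply/idP/idP; rewrite inE/= in_itv/=.
have chi1 x : `|chi x| <= 1 by rewrite /chi; case: ltP; rewrite ?normr1 ?normr0.
have sschi : sqint mu (fun x => s x * chi x) by exact: sqintM_bounded.
pose phi (p : mpoly.mpoly n R) x := s x * evalp p x.
have phi_sq p : sqint mu (phi p).
  split; first by apply: measurable_funM => //; case: (sqint_evalp hz p).
  have := sqintM (sqint_norm sh) (sqint_evalp hz (p ^+ 2)).
  by congr (integ mu _); apply/funext => x; rewrite /phi evalpX exprMn s2.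
have phi_lin a p q x : phi (a *: p + q) x = a * phi p x + phi q x.
  by rewrite /phi evalp_lin; ring.
pose L p := \int[mu]_x (s x * chi x * phi p x).
have L_lin a p q : L (a *: p + q) = a * L p + L q.
  rewrite /L -IntZ; last exact: sqintM.
  rewrite -IntD; [|by apply: integZ; exact: sqintM|exact: sqintM].
  by apply: eq_Rintegral => x _; rewrite phi_lin; ring.
have L_le p : L p ^+ 2 <= \int[mu]_x ((s x * chi x) ^+ 2) * \int[mu]_x (phi p x ^+ 2).
  exact: cauchy_schwarz.
have C0 : 0 <= \int[mu]_x ((s x * chi x) ^+ 2) by apply: Int_ge0 => x; exact: sqr_ge0.
(* H is the projection of s 1_(h < 0) on the closure of the functions s p *)
have [H [v_ [sH Hv HL]]] := riesz_representation phi_lin L_lin phi_sq C0 L_le.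
pose D x := H x - s x * chi x.
have sD : sqint mu D by exact: sqintB.
have sD0 : {ae mu, forall x, s x * D x = 0}.
  apply: moments_eq0_ae_eq0 => [a|a|a i].
  - have := sqintM (phi_sq (mpoly.mpolyX R a)) sD.
    by congr (integ mu _); apply/funext => x; rewrite /phi evalp_mpolyX mulrAC.
  - have := HL (mpoly.mpolyX R a); rewrite /L => /esym/eqP; rewrite -subr_eq0 => /eqP.
    rewrite -IntB; [|exact: sqintM|exact: sqintM] => e; rewrite -[RHS]e.
    by apply: eq_Rintegral => x _; rewrite /phi evalp_mpolyX /D; ring.
  - exact: (weighted_moments_quasianalytic hz hcarleman a i sh ms s2 sD).
pose sg x := Num.sg (h x).
have msg : measurable_fun setT sg.
  rewrite (_ : sg = fun x => (0 < h x)%R%:R - chi x).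
    apply: measurable_funB => //.
    rewrite (_ : (fun x => _) = \1_(h @^-1` `]0, +oo[%classic)).
      by apply: measurable_indic; rewrite -[X in measurable X]setTI; exact: mh.
    apply/funext => x; rewrite indicE; congr (_%:R); congr nat_of_bool.
    by apply/idP/idP; rewrite inE/= in_itv/= andbT.
  by apply/funext => x; rewrite /sg /chi; case: sgrP => _; rewrite ?subr0 ?subrr ?sub0r.
have sg1 x : `|sg x| <= 1 by rewrite normr_sg; case: eqP.
have sHsg : sqint mu (fun x => H x * sg x) by exact: sqintM_bounded.
have iHsg : integ mu (fun x => H x ^+ 2 * sg x).
  by have := sqintM sH sHsg; congr (integ mu _); apply/funext => x; ring.
have HP : 0 <= \int[mu]_x (H x ^+ 2 * sg x).
  rewrite -oppr_le0.
  apply: (@geom_bounded_le0 _ _ (2 * Num.sqrt (\int[mu]_x ((H x * sg x) ^+ 2)) + 1)) => k.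
  have sk : sqint mu (fun x => phi (v_ k) x - H x) by exact: sqintB.
  have c1 : `|\int[mu]_x (H x * sg x * (phi (v_ k) x - H x))| <=
      2^-1 ^+ k * Num.sqrt (\int[mu]_x ((H x * sg x) ^+ 2)).
    apply: norm_le_geom; rewrite [leRHS]mulrC.
    apply: le_trans (cauchy_schwarz sHsg sk) _.
    by rewrite ler_wpM2l// Int_ge0// => x; exact: sqr_ge0.
  have sksg : sqint mu (fun x => (phi (v_ k) x - H x) * sg x) by exact: sqintM_bounded.
  have iksg : integ mu (fun x => (phi (v_ k) x - H x) ^+ 2 * sg x).
    by have := sqintM sk sksg; congr (integ mu _); apply/funext => x; ring.
  have c2 : `|\int[mu]_x ((phi (v_ k) x - H x) ^+ 2 * sg x)| <= 2^-1 ^+ k.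
    apply: le_trans (Int_norm_le iksg) _.
    apply: (@le_trans _ _ (\int[mu]_x ((phi (v_ k) x - H x) ^+ 2))).
      apply: Int_le; [exact: integ_norm|by case: sk|].
      by move=> x; rewrite normrM ger0_norm ?sqr_ge0// ler_piMr ?sqr_ge0.
    apply: le_trans (Hv k) _; rewrite lerXn2r ?nnegrE ?invr_ge0//.
    by rewrite lef_pV2 ?posrE// ler_nat.
  have : 0 <= \int[mu]_x (H x ^+ 2 * sg x) +
      (2 * \int[mu]_x (H x * sg x * (phi (v_ k) x - H x)) +
       \int[mu]_x ((phi (v_ k) x - H x) ^+ 2 * sg x)).
    have iHk := sqintM sHsg sk.
    rewrite -IntZ// -IntD//; last exact: integZ.
    rewrite -IntD//; last by apply: integD => //; exact: integZ.
    apply: le_trans (hpos (v_ k)) _; rewrite le_eqVlt; apply/orP; left; apply/eqP.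
    apply: eq_Rintegral => x _.
    have -> : H x ^+ 2 * sg x + (2 * (H x * sg x * (phi (v_ k) x - H x)) +
       (phi (v_ k) x - H x) ^+ 2 * sg x) = phi (v_ k) x ^+ 2 * sg x by ring.
    by rewrite /phi exprMn s2 mulrAC mulrC -[`|_| * _]mulrC /sg -numEsg mulrC.
  move: c1 c2; rewrite !ler_norml => /andP[_ c1] /andP[_ c2].
  move: c1 c2; set q := 2^-1 ^+ k; set w := Num.sqrt _; nra.
pose hm x := `|h x| * chi x.
have ihm : integ mu hm.
  apply: integM_bounded => //.
  by have := is2; under eq_fun do rewrite s2.
have hm0 x : 0 <= hm x by rewrite mulr_ge0// /chi ler0n.
have Hhm : {ae mu, forall x, H x ^+ 2 * sg x = - hm x}.
  apply: filterS sD0 => x /eqP; rewrite mulf_eq0 => /orP[/eqP s0|/eqP Dx].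
    have := s2 x; rewrite s0 expr0n/= => /esym/eqP; rewrite normr_eq0 => /eqP h0.
    by rewrite /hm /sg /chi h0 sgr0 mulr0 normr0 mul0r oppr0.
  move/eqP: Dx; rewrite /D subr_eq0 => /eqP ->.
  rewrite exprMn s2 /hm /sg /chi; have [hx|hx|hx] := ltrgtP (h x) 0.
  - by rewrite (ltr0_sg hx) expr1n !mulr1 mulrN1.
  - by rewrite expr0n/= !mulr0 mul0r oppr0.
  - by rewrite hx normr0 !mul0r oppr0.
have Ihm : \int[mu]_x hm x <= 0.
  rewrite -oppr_ge0; apply: le_trans HP _; rewrite le_eqVlt; apply/orP; left.
  apply/eqP; rewrite -mulN1r -IntZ//; congr fine; apply: ae_eq_integral => //.
  - exact: measurable_int iHsg.
  - exact: measurable_int (integZ (-1) ihm).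
  - by apply: filterS Hhm => x -> _; rewrite mulN1r.
have : ae_eq mu setT (EFin \o hm) (cst 0%E).
  apply/ae_eq_integral_abs => //; first exact: measurable_int ihm.
  rewrite (eq_integral (fun x => (hm x)%:E)); last first.
    by move=> x _; rewrite /= ger0_norm.
  rewrite (Int_EFin ihm); congr (_%:E); apply/eqP; rewrite eq_le Ihm.
  exact: Int_ge0.
apply: filterS => x /(_ Logic.I) /= [/eqP].
rewrite /hm /chi mulf_eq0 normr_eq0; case: ltP => //= hx.
by rewrite oner_eq0 orbF lt_eqF.
Qed.

End positivity.

(** * Representation with a bounded density *)

Theorem theorem4 (R : realType) (n : nat)
  (mu : {finite_measure set (n.-tuple R) -> \bar R})
  (z : mpoly.multinom n -> R)
  (hz : has_moments mu z)
  (hcarleman : generalized_carleman z)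
  (y : mpoly.multinom n -> R)
  (hy : exists kappa : R, 0 < kappa /\
    forall f : mpoly.mpoly n R,
      0 <= riesz_functional y (f ^+ 2) <= kappa * riesz_functional z (f ^+ 2)) :
  exists nu : {finite_measure set (n.-tuple R) -> \bar R},
    has_moments nu y /\ uniformly_absolutely_continuous nu mu.
Proof.
have [kappa [kappa0 hk]] := hy.
pose L (f : mpoly.mpoly n R) := riesz_functional y f.
have L_lin a f g : L (a *: f + g) = a * L f + L g by exact: riesz_functional_lin.
have Lsq_le f : L (f ^+ 2) <= kappa * \int[mu]_x (evalp f x ^+ 2).
  have /andP[_] := hk f; rewrite (riesz_functional_Int hz).
  by under eq_Rintegral do rewrite evalpX.
have Lsq_ge0 f : 0 <= L (f ^+ 2) by have /andP[] := hk f.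
have L1_ge0 : 0 <= L 1 by have := Lsq_ge0 1; rewrite expr1n.
have L_le f : L f ^+ 2 <= (kappa * L 1) * \int[mu]_x (evalp f x ^+ 2).
  rewrite mulrAC; apply: (@le_trans _ _ (L (f ^+ 2) * L 1)); last by rewrite ler_wpM2r.
  apply: discriminant_le0 => // t.
  have := Lsq_ge0 (f + t *: 1).
  have -> : (f + t *: 1) ^+ 2 = (2 * t) *: f + ((t ^+ 2) *: 1 + f ^+ 2).
    rewrite sqrrD -scalerAr mulr1 exprZn expr1n mulr_natl -scalerMnl.
    by rewrite [RHS]addrA [RHS]addrC addrA.
  by rewrite !L_lin; lra.
have C0 : 0 <= kappa * L 1 by rewrite mulr_ge0// ltW.
have [h [_ [sh _ hL]]] := riesz_representation (@evalp_lin R n) L_lin (sqint_evalp hz) C0 L_le.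
have [mh _] := sh.
have Int_h f : \int[mu]_x (h x * evalp f x ^+ 2) = L (f ^+ 2).
  by rewrite hL; apply: eq_Rintegral => x _; rewrite evalpX.
have h_ge0 : {ae mu, forall x, 0 <= h x}.
  apply: (ae_ge0_of_squares hz hcarleman sh) => f.
  by rewrite Int_h.
have sk : sqint mu (fun x => kappa - h x).
  apply: sqintB => //; have := sqintZ kappa (sqint_evalp hz 1).
  by congr (sqint mu _); apply/funext => x; rewrite evalp1 mulr1.
have h_le : {ae mu, forall x, 0 <= kappa - h x}.
  apply: (ae_ge0_of_squares hz hcarleman sk) => f.
  have := Lsq_le f; rewrite -Int_h -subr_ge0.
  have [_ if2] := sqint_evalp hz f.
  rewrite -IntZ// -IntB; [|exact: integZ|]; last first.
    have := sqintM sh (sqint_evalp hz (f ^+ 2)).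
    by congr (integ mu _); apply/funext => x; rewrite evalpX.
  by move=> /le_trans; apply; rewrite le_eqVlt; apply/orP; left; apply/eqP;
    apply: eq_Rintegral => x _; ring.
(* h is only known to lie in [0, kappa] almost everywhere; g does so everywhere *)
pose g x := Num.max 0 (Num.min kappa (h x)).
have mg : measurable_fun setT g.
  by apply: measurable_maxr => //; exact: measurable_minr.
have g0 x : 0 <= g x by rewrite le_max lexx.
have gk x : g x <= kappa by rewrite ge_max ltW//= ge_min lexx.
have gh : {ae mu, forall x, g x = h x}.
  apply: filterS2 h_ge0 h_le => x h0 hk'; rewrite /g min_r; last by rewrite -subr_ge0.
  exact: max_r.
exists (@density_measure _ _ _ mu g kappa mg g0 gk); split; last first.
  by split; [exact: density_dominates|exact: density_RN_bounded].
move=> a; have [ia ea] := density_integral mg g0 gk (integ_monomial hz a).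
split => //; rewrite ea.
have e := hL (mpoly.mpolyX R a); rewrite /L riesz_functional_mpolyX in e.
rewrite e -Int_EFin; last exact: sqintM sh (sqint_evalp hz _).
apply: ae_eq_integral => //.
- by apply: measurable_int (sqintM sh (sqint_evalp hz _)).
- by apply/measurable_EFinP/measurable_funM => //; exact: measurable_monomial.
- by apply: filterS gh => x -> _; rewrite evalp_mpolyX.
Qed.
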